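(* Let $\Bbbk$ be an arbitrary commutative ring and $t\in\Bbbk$. The functor $\Psi_t\colon\mathcal{P}ar(t)\to\mathcal{H}_{\uparrow\downarrow}(t)$ is faithful.
   Context: Partition category. For $m,\ell\in\mathbb{N}$, a partition of type $\binom{\ell}{m}$, written $D\colon m\to\ell$, is a set partition of $\{1,\dots,m,1',\dots,\ell'\}$; its parts are called blocks. It is drawn with bottom vertices $1,\dots,m$ and top vertices $1',\dots,\ell'$, numbered from right to left. For $D'\colon m\to\ell$ and $D\colon\ell\to k$, stack $D$ on top of $D'$, identifying the bottom vertices of $D$ with the top vertices of $D'$; let $\alpha(D,D')$ be the number of connected components containing only middle vertices, and let $D\star D'\colon m\to k$ be the partition in which vertices are in the same block iff they are connected in the stacked diagram. $\mathcal{P}ar(t)$ is the strict $\Bbbk$-linear monoidal category with objects $m\in\mathbb{N}$, with $\mathrm{Hom}(m,\ell)$ the free $\Bbbk$-module on partitions of type $\binom{\ell}{m}$, composition $D\circ D'=t^{\alpha(D,D')}D\star D'$ extended bilinearly, and tensor product given by addition on objects and horizontal juxtaposition on morphisms. It is generated as a $\Bbbk$-linear monoidal category by the object $1$ and the morphisms $\mu\colon2\to1$, $\delta\colon1\to2$, $\eta\colon0\to1$, $\varepsilon\colon1\to0$ (the unique one-block partitions of these types) and $s\colon2\to2$ with blocks $\{1,2'\},\{2,1'\}$. Heisenberg category. $\mathcal{H}$ is the strict $\Bbbk$-linear monoidal category with unit $\mathbb{1}$ generated by objects $\uparrow,\downarrow$ (juxtaposition is tensor product) and morphisms $X\colon\uparrow\uparrow\to\uparrow\uparrow$,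 $c\colon\mathbb{1}\to\downarrow\uparrow$, $d\colon\uparrow\downarrow\to\mathbb{1}$, $c'\colon\mathbb{1}\to\uparrow\downarrow$, $d'\colon\downarrow\uparrow\to\mathbb{1}$, subject to $X\circ X=1_{\uparrow\uparrow}$; $(X\otimes1_\uparrow)(1_\uparrow\otimes X)(X\otimes1_\uparrow)=(1_\uparrow\otimes X)(X\otimes1_\uparrow)(1_\uparrow\otimes X)$; $(d\otimes1_\uparrow)(1_\uparrow\otimes c)=1_\uparrow$; $(1_\downarrow\otimes d)(c\otimes1_\downarrow)=1_\downarrow$; $l\circ r=1_{\uparrow\downarrow}$; $r\circ l=1_{\downarrow\uparrow}-c\circ d'$; $(d'\otimes1_\uparrow)(1_\downarrow\otimes X)(c\otimes1_\uparrow)=0$; $d'\circ c=1_{\mathbb{1}}$; where $l=(d'\otimes1_\uparrow\otimes1_\downarrow)(1_\downarrow\otimes X\otimes1_\downarrow)(1_\downarrow\otimes1_\uparrow\otimes c')\colon\downarrow\uparrow\to\uparrow\downarrow$ and $r=(1_\downarrow\otimes1_\uparrow\otimes d)(1_\downarrow\otimes X\otimes1_\downarrow)(c\otimes1_\uparrow\otimes1_\downarrow)\colon\uparrow\downarrow\to\downarrow\uparrow$. Put $Y=(d'\otimes1_\downarrow\otimes1_\downarrow)(1_\downarrow\otimes l\otimes1_\downarrow)(1_\downarrow\otimes1_\downarrow\otimes c')\colon\downarrow\downarrow\to\downarrow\downarrow$. $\mathcal{H}_{\uparrow\downarrow}$ is the full monoidal subcategory with objects $(\uparrow\downarrow)^k$,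 $k\ge0$; the clockwise bubble $d\circ c'$ is strictly central in it, and $\mathcal{H}_{\uparrow\downarrow}(t)$ is the quotient of $\mathcal{H}_{\uparrow\downarrow}$ by the relation $d\circ c'=t\,1_{\mathbb{1}}$. The functor $\Psi_t\colon\mathcal{P}ar(t)\to\mathcal{H}_{\uparrow\downarrow}(t)$ is the strict $\Bbbk$-linear monoidal functor with $k\mapsto(\uparrow\downarrow)^k$, $\mu\mapsto1_\uparrow\otimes d'\otimes1_\downarrow$, $\delta\mapsto1_\uparrow\otimes c\otimes1_\downarrow$, $\eta\mapsto c'$, $\varepsilon\mapsto d$, $s\mapsto(1_\uparrow\otimes r\otimes1_\downarrow)\circ(X\otimes Y)\circ(1_\uparrow\otimes l\otimes1_\downarrow)+1_\uparrow\otimes(c\circ d')\otimes1_\downarrow$. *)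

(* Defs.v *)
From HB Require Import structures.
From mathcomp Require Import all_boot all_order all_algebra.
From mathcomp Require Import boolp.

Set Implicit Arguments.
Unset Strict Implicit.
Unset Printing Implicit Defensive.

Import GRing.Theory.
Local Open Scope ring_scope.
Local Open Scope quotient_scope.

(* Vertices of a diagram m -> l: [inl i] is the bottom vertex i+1 and [inr j]
   is the top vertex (j+1)'. *)
Definition vertex (m l : nat) : finType := ('I_m + 'I_l)%type.

Definition diagram (m l : nat) : finType :=
  {P : {set {set vertex m l}} | partition P [set: vertex m l]}.

Definition same_block m l (D : diagram m l) : rel (vertex m l) :=
  fun x y => y \in pblock (val D) x.

Lemma same_block_equiv m l (D : diagram m l) : equivalence_rel (same_block D).
Proof.
case: D => P /= Pp x y z; rewrite /same_block /=.
have xP u : u \in cover P by rewrite (cover_partition Pp) inE.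
split; first by rewrite mem_pblock xP.
have tP := partition_trivIset Pp.
by rewrite -!eq_pblock // => /eqP ->.
Qed.

Lemma same_blockC m l (D : diagram m l) : symmetric (same_block D).
Proof.
have /equivalence_relP[r tr] := same_block_equiv D.
by move=> x y; apply/idP/idP=> /tr <-.
Qed.

Definition diagram_of m l (r : rel (vertex m l)) (rE : equivalence_rel r) :
  diagram m l :=
  Sub (equivalence_partition r [set: vertex m l])
      (equivalence_partitionP (in3W rE)).

Lemma diagram_ofE m l (r : rel (vertex m l)) (rE : equivalence_rel r) x y :
  same_block (diagram_of rE) x y = r x y.
Proof.
by rewrite /same_block /= (pblock_equivalence_partition (in3W rE)) ?inE.
Qed.

Lemma fibers_equiv (T : Type) (U : eqType) (f : T -> U) :
  equivalence_rel [rel x y | f x == f y].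
Proof. by move=> x y z; split=> //= /eqP ->. Qed.

Section Stack.
Variables (m l k : nat) (D : diagram l k) (D' : diagram m l).

(* D is stacked on top of D'; the three summands are the bottom, middle and top
   vertices. *)
Definition stacked : finType := ('I_m + 'I_l + 'I_k)%type.

Definition lower (x : vertex m l) : stacked := inl x.
Definition upper (x : vertex l k) : stacked :=
  match x with inl j => inl (inr j) | inr h => inr h end.
Definition outer (x : vertex m k) : stacked :=
  match x with inl i => inl (inl i) | inr h => inr h end.
Definition middle : {set stacked} := [set (inl (inr j) : stacked) | j : 'I_l].

Definition stack_adj : rel stacked := fun u v =>
  [exists x, exists y, [&& same_block D' x y, u == lower x & v == lower y]]
  || [exists x, exists y, [&& same_block D x y, u == upper x & v == upper y]].

Lemma stack_adj_sym : connect_sym stack_adj.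
Proof.
apply: sym_connect_sym => u v; congr (_ || _).
  by apply/existsP/existsP=> -[x /existsP[y /and3P[h /eqP-> /eqP->]]];
     exists y; apply/existsP; exists x; rewrite same_blockC h !eqxx.
by apply/existsP/existsP=> -[x /existsP[y /and3P[h /eqP-> /eqP->]]];
   exists y; apply/existsP; exists x; rewrite same_blockC h !eqxx.
Qed.

Lemma connect_equiv : equivalence_rel (connect stack_adj).
Proof.
apply/equivalence_relP; split=> [x|x y xy z]; first exact: connect0.
exact: (same_connect stack_adj_sym).
Qed.

Lemma connect_outer_equiv :
  equivalence_rel (fun x y => connect stack_adj (outer x) (outer y)).
Proof. by move=> x y z; have := connect_equiv (outer x) (outer y) (outer z). Qed.

Definition components : {set {set stacked}} :=
  equivalence_partition (connect stack_adj) [set: stacked].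

Definition loops : nat := #|[set C in components | C \subset middle]|.

Definition star : diagram m k := diagram_of connect_outer_equiv.

End Stack.

Section Juxtapose.
Variables (m l m' l' : nat) (D : diagram m l) (D' : diagram m' l').

(* Vertices are numbered from right to left and D' is drawn to the right of D,
   so the first m' bottom and the first l' top vertices come from D'. *)
Definition juxt_side (x : vertex (m + m') (l + l')) :
    vertex m l + vertex m' l' :=
  match x with
  | inl i => match split (cast_ord (addnC m m') i) with
             | inl i' => inr (inl i')
             | inr i0 => inl (inl i0)
             end
  | inr j => match split (cast_ord (addnC l l') j) with
             | inl j' => inr (inr j')
             | inr j0 => inl (inr j0)
             end
  end.

Definition juxt_rel : rel (vertex (m + m') (l + l')) := fun x y =>
  match juxt_side x, juxt_side y with
  | inl u, inl v => same_block D u v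
  | inr u, inr v => same_block D' u v
  | _, _ => false
  end.

Lemma juxt_rel_equiv : equivalence_rel juxt_rel.
Proof.
apply/equivalence_relP; rewrite /juxt_rel; split=> [x|x y].
  by case: (juxt_side x) => u; exact: (same_block_equiv _ u u u).1.
case: (juxt_side x) => u; case: (juxt_side y) => v // uv z;
  case: (juxt_side z) => w //; exact: (same_block_equiv _ u v w).2.
Qed.

Definition juxt : diagram (m + m') (l + l') := diagram_of juxt_rel_equiv.

End Juxtapose.

(* Blocks {i, i'}. *)
Definition idp (m : nat) : diagram m m :=
  diagram_of (fibers_equiv (fun x : vertex m m =>
    match x with inl i => i | inr i => i end)).

Definition one_block (m l : nat) : diagram m l :=
  diagram_of (fibers_equiv (fun=> tt)).

(* Blocks {1, 2'} and {2, 1'}: the top vertex j' is joined to the bottom vertex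
   of the other index. *)
Definition swap : diagram 2 2 :=
  diagram_of (fibers_equiv (fun x : vertex 2 2 =>
    match x with inl i => i | inr j => rev_ord j end)).

Section Par.
Variables (R : comPzRingType) (t : R).

Definition par_hom (m l : nat) : lmodType R := {ffun diagram m l -> R^o}.

Definition par_diag m l (D : diagram m l) : par_hom m l :=
  [ffun E => (E == D)%:R].

Definition par_id m : par_hom m m := par_diag (idp m).

Definition par_comp m l k (f : par_hom l k) (g : par_hom m l) : par_hom m k :=
  \sum_(D : diagram l k) \sum_(D' : diagram m l)
    (f D * g D' * t ^+ loops D D') *: par_diag (star D D').

Definition par_tens m l m' l' (f : par_hom m l) (g : par_hom m' l') :
    par_hom (m + m') (l + l') :=
  \sum_(D : diagram m l) \sum_(D' : diagram m' l')
    (f D * g D') *: par_diag (juxt D D').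

End Par.

(* The objects of the Heisenberg category H are the words in the two arrows, the
   tensor product being [++]. *)
Inductive arrow := Up | Dn.

Notation word := (seq arrow).

Section Heisenberg.
Variable R : comPzRingType.

(* Formal morphisms, before quotienting by the relation [heq] below. *)
Inductive term : word -> word -> Type :=
| tzero a b : term a b
| tadd a b : term a b -> term a b -> term a b
| topp a b : term a b -> term a b
| tscale a b : R -> term a b -> term a b
| tid a : term a a
| tcomp a b c : term b c -> term a b -> term a c
| ttens a b a' b' : term a b -> term a' b' -> term (a ++ a') (b ++ b')
| gX : term [:: Up; Up] [:: Up; Up]
| gc : term [::] [:: Dn; Up]
| gd : term [:: Up; Dn] [::]
| gc' : term [::] [:: Up; Dn]
| gd' : term [:: Dn; Up] [::].

Local Infix "**" := tcomp (at level 40, left associativity).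
Local Infix "##" := ttens (at level 35, right associativity).
Local Notation "1_u" := (tid [:: Up]).
Local Notation "1_d" := (tid [:: Dn]).

Definition tcast a b a' b' (ea : a = a') (eb : b = b') (f : term a b) :
    term a' b' :=
  ecast x (term x b') ea (ecast y (term a y) eb f).

Definition ml : term [:: Dn; Up] [:: Up; Dn] :=
  (gd' ## 1_u ## 1_d) ** (1_d ## gX ## 1_d) ** (1_d ## 1_u ## gc').

Definition mr : term [:: Up; Dn] [:: Dn; Up] :=
  (1_d ## 1_u ## gd) ** (1_d ## gX ## 1_d) ** (gc ## 1_u ## 1_d).

Definition mY : term [:: Dn; Dn] [:: Dn; Dn] :=
  (gd' ## 1_d ## 1_d) ** (1_d ## ml ## 1_d) ** (1_d ## 1_d ## gc').

Local Notation tsub f g := (tadd f (topp g)).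

(* Equality of morphisms in H: the congruence generated by the axioms of strict
   k-linear monoidal categories and the defining relations. *)
Inductive heq : forall a b, term a b -> term a b -> Prop :=
| heq_refl a b (f : term a b) : heq f f
| heq_sym a b (f g : term a b) : heq f g -> heq g f
| heq_trans a b (f g h : term a b) : heq f g -> heq g h -> heq f h
| heq_add a b (f f' g g' : term a b) :
    heq f f' -> heq g g' -> heq (tadd f g) (tadd f' g')
| heq_opp a b (f f' : term a b) : heq f f' -> heq (topp f) (topp f')
| heq_scale a b r (f f' : term a b) :
    heq f f' -> heq (tscale r f) (tscale r f')
| heq_comp a b c (f f' : term b c) (g g' : term a b) :
    heq f f' -> heq g g' -> heq (f ** g) (f' ** g')
| heq_tens a b a' b' (f f' : term a b) (g g' : term a' b') :
    heq f f' -> heq g g' -> heq (f ## g) (f' ## g')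
| heq_addA a b (f g h : term a b) :
    heq (tadd f (tadd g h)) (tadd (tadd f g) h)
| heq_addC a b (f g : term a b) : heq (tadd f g) (tadd g f)
| heq_add0 a b (f : term a b) : heq (tadd (tzero a b) f) f
| heq_addN a b (f : term a b) : heq (tadd (topp f) f) (tzero a b)
| heq_scaleA a b r s (f : term a b) :
    heq (tscale r (tscale s f)) (tscale (r * s) f)
| heq_scale1 a b (f : term a b) : heq (tscale 1 f) f
| heq_scaleDr a b r (f g : term a b) :
    heq (tscale r (tadd f g)) (tadd (tscale r f) (tscale r g))
| heq_scaleDl a b r s (f : term a b) :
    heq (tscale (r + s) f) (tadd (tscale r f) (tscale s f))
| heq_compDl a b c (f f' : term b c) (g : term a b) :
    heq (tadd f f' ** g) (tadd (f ** g) (f' ** g))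
| heq_compDr a b c (f : term b c) (g g' : term a b) :
    heq (f ** tadd g g') (tadd (f ** g) (f ** g'))
| heq_compZl a b c r (f : term b c) (g : term a b) :
    heq (tscale r f ** g) (tscale r (f ** g))
| heq_compZr a b c r (f : term b c) (g : term a b) :
    heq (f ** tscale r g) (tscale r (f ** g))
| heq_tensDl a b a' b' (f f' : term a b) (g : term a' b') :
    heq (tadd f f' ## g) (tadd (f ## g) (f' ## g))
| heq_tensDr a b a' b' (f : term a b) (g g' : term a' b') :
    heq (f ## tadd g g') (tadd (f ## g) (f ## g'))
| heq_tensZl a b a' b' r (f : term a b) (g : term a' b') :
    heq (tscale r f ## g) (tscale r (f ## g))
| heq_tensZr a b a' b' r (f : term a b) (g : term a' b') :
    heq (f ## tscale r g) (tscale r (f ## g))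
| heq_compA a b c e (f : term c e) (g : term b c) (h : term a b) :
    heq (f ** (g ** h)) (f ** g ** h)
| heq_compIl a b (f : term a b) : heq (tid b ** f) f
| heq_compIr a b (f : term a b) : heq (f ** tid a) f
| heq_tensI a b : heq (tid a ## tid b) (tid (a ++ b))
| heq_interchange a b c a' b' c' (f : term b c) (g : term a b)
      (f' : term b' c') (g' : term a' b') :
    heq ((f ** g) ## (f' ** g')) ((f ## f') ** (g ## g'))
| heq_tensA a b a' b' a'' b'' (f : term a b) (g : term a' b')
      (h : term a'' b'') :
    heq (tcast (catA a a' a'') (catA b b' b'') (f ## (g ## h)))
        ((f ## g) ## h)
| heq_tensIl a b (f : term a b) : heq (tid [::] ## f) f
| heq_tensIr a b (f : term a b) :
    heq (tcast (cats0 a) (cats0 b) (f ## tid [::])) f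
| heq_XX : heq (gX ** gX) (tid [:: Up; Up])
| heq_braid :
    heq ((gX ## 1_u) ** (1_u ## gX) ** (gX ## 1_u))
        ((1_u ## gX) ** (gX ## 1_u) ** (1_u ## gX))
| heq_zigzag_up : heq ((gd ## 1_u) ** (1_u ## gc)) 1_u
| heq_zigzag_dn : heq ((1_d ## gd) ** (gc ## 1_d)) 1_d
| heq_lr : heq (ml ** mr) (tid [:: Up; Dn])
| heq_rl : heq (mr ** ml) (tsub (tid [:: Dn; Up]) (gc ** gd'))
| heq_curl :
    heq ((gd' ## 1_u) ** (1_d ## gX) ** (gc ## 1_u)) (tzero [:: Up] [:: Up])
| heq_bubble : heq (gd' ** gc) (tid [::]).

(* The object (Up Dn)^k. The full subcategory H_ud has the natural numbers as
   objects, k standing for [ud k], with tensor product given by addition. *)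
Fixpoint ud (k : nat) : word :=
  if k is k'.+1 then [:: Up, Dn & ud k'] else [::].

Lemma udD m n : ud m ++ ud n = ud (m + n).
Proof. by elim: m => //= m ->. Qed.

Definition ud_tens m l m' l' (f : term (ud m) (ud l))
    (g : term (ud m') (ud l')) : term (ud (m + m')) (ud (l + l')) :=
  tcast (udD m m') (udD l l') (f ## g).

Variable t : R.

(* Equality of morphisms in the quotient H_ud(t) of H_ud by the relation
   d o c' = t. The congruence must be generated inside H_ud, not in H, where the
   clockwise bubble is not central: composites and tensor products below only
   involve morphisms between objects [ud k]. *)
Inductive hteq : forall m l, term (ud m) (ud l) -> term (ud m) (ud l) -> Prop :=
| hteq_heq m l (f g : term (ud m) (ud l)) : heq f g -> hteq f g
| hteq_bubble : @hteq 0 0 (gd ** gc') (tscale t (tid [::]))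
| hteq_sym m l (f g : term (ud m) (ud l)) :
    hteq f g -> hteq g f
| hteq_trans m l (f g h : term (ud m) (ud l)) :
    hteq f g -> hteq g h -> hteq f h
| hteq_add m l (f f' g g' : term (ud m) (ud l)) :
    hteq f f' -> hteq g g' -> hteq (tadd f g) (tadd f' g')
| hteq_opp m l (f f' : term (ud m) (ud l)) :
    hteq f f' -> hteq (topp f) (topp f')
| hteq_scale m l r (f f' : term (ud m) (ud l)) :
    hteq f f' -> hteq (tscale r f) (tscale r f')
| hteq_comp m l k (f f' : term (ud l) (ud k)) (g g' : term (ud m) (ud l)) :
    hteq f f' -> hteq g g' -> hteq (f ** g) (f' ** g')
| hteq_tens m l m' l' (f f' : term (ud m) (ud l))
      (g g' : term (ud m') (ud l')) :
    hteq f f' -> hteq g g' -> hteq (ud_tens f g) (ud_tens f' g').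

Lemma hteq_refl m l (f : term (ud m) (ud l)) : hteq f f.
Proof. exact/hteq_heq/heq_refl. Qed.

Section Hom.
Variables m l : nat.

HB.instance Definition _ := gen_eqMixin (term (ud m) (ud l)).
HB.instance Definition _ := gen_choiceMixin (term (ud m) (ud l)).

Definition hteqb : rel (term (ud m) (ud l)) := fun f g => `[< hteq f g >].

Lemma hteqb_equiv : equiv_class_of hteqb.
Proof.
split=> [f|f g|g f h]; first exact/asboolP/hteq_refl.
  by apply/asboolP/asboolP; exact: hteq_sym.
by move=> /asboolP fg /asboolP gh; apply/asboolP/(hteq_trans fg).
Qed.

Canonical hteq_equiv := EquivRelPack hteqb_equiv.

Definition ud_hom := {eq_quot hteqb}.
HB.instance Definition _ : EqQuotient _ hteqb ud_hom := EqQuotient.on ud_hom.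
HB.instance Definition _ := Choice.on ud_hom.

Definition ud_class (f : term (ud m) (ud l)) : ud_hom := \pi_ud_hom f.

Lemma ud_classP f g : ud_class f = ud_class g <-> hteq f g.
Proof. by split=> [/eqmodP/asboolP|fg]; last exact/eqmodP/asboolP. Qed.

Lemma ud_reprK (f : ud_hom) : ud_class (repr f) = f.
Proof. exact: reprK. Qed.

Lemma hteq_repr f : hteq (repr (ud_class f)) f.
Proof. by apply/ud_classP; rewrite ud_reprK. Qed.

Lemma ud_classW (P : ud_hom -> Prop) :
  (forall f, P (ud_class f)) -> forall f, P f.
Proof. by move=> Pc f; rewrite -(ud_reprK f). Qed.

Definition ud_zero : ud_hom := ud_class (tzero _ _).
Definition ud_add (f g : ud_hom) : ud_hom := ud_class (tadd (repr f) (repr g)).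
Definition ud_opp (f : ud_hom) : ud_hom := ud_class (topp (repr f)).
Definition ud_scale (r : R) (f : ud_hom) : ud_hom :=
  ud_class (tscale r (repr f)).

Lemma ud_addE f g : ud_add (ud_class f) (ud_class g) = ud_class (tadd f g).
Proof. by apply/ud_classP/hteq_add; exact: hteq_repr. Qed.

Lemma ud_oppE f : ud_opp (ud_class f) = ud_class (topp f).
Proof. by apply/ud_classP/hteq_opp/hteq_repr. Qed.

Lemma ud_scaleE r f : ud_scale r (ud_class f) = ud_class (tscale r f).
Proof. by apply/ud_classP/hteq_scale/hteq_repr. Qed.

Fact ud_addA : associative ud_add.
Proof.
elim/ud_classW=> f; elim/ud_classW=> g; elim/ud_classW=> h.
by rewrite !ud_addE; apply/ud_classP/hteq_heq/heq_addA.
Qed.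

Fact ud_addC : commutative ud_add.
Proof.
elim/ud_classW=> f; elim/ud_classW=> g.
by rewrite !ud_addE; apply/ud_classP/hteq_heq/heq_addC.
Qed.

Fact ud_add0 : left_id ud_zero ud_add.
Proof.
by elim/ud_classW=> f; rewrite ud_addE; apply/ud_classP/hteq_heq/heq_add0.
Qed.

Fact ud_addN : left_inverse ud_zero ud_opp ud_add.
Proof.
elim/ud_classW=> f; rewrite ud_oppE ud_addE.
exact/ud_classP/hteq_heq/heq_addN.
Qed.

HB.instance Definition _ :=
  GRing.isZmodule.Build ud_hom ud_addA ud_addC ud_add0 ud_addN.

Lemma ud_classD f g : ud_class f + ud_class g = ud_class (tadd f g).
Proof. exact: ud_addE. Qed.

Lemma ud_classN f : - ud_class f = ud_class (topp f).
Proof. exact: ud_oppE. Qed.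

Fact ud_scaleA r s f : ud_scale r (ud_scale s f) = ud_scale (r * s) f.
Proof.
elim/ud_classW: f => f; rewrite !ud_scaleE.
exact/ud_classP/hteq_heq/heq_scaleA.
Qed.

Fact ud_scale1 : left_id 1 ud_scale.
Proof.
by elim/ud_classW=> f; rewrite ud_scaleE; apply/ud_classP/hteq_heq/heq_scale1.
Qed.

Fact ud_scaleDr : right_distributive ud_scale +%R.
Proof.
move=> r; elim/ud_classW=> f; elim/ud_classW=> g.
rewrite ud_classD !ud_scaleE ud_classD.
exact/ud_classP/hteq_heq/heq_scaleDr.
Qed.

Fact ud_scaleDl f : {morph ud_scale^~ f : r s / r + s}.
Proof.
move=> r s; elim/ud_classW: f => f.
rewrite !ud_scaleE ud_classD; exact/ud_classP/hteq_heq/heq_scaleDl.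
Qed.

HB.instance Definition _ :=
  GRing.Zmodule_isLmodule.Build R ud_hom
    ud_scaleA ud_scale1 ud_scaleDr ud_scaleDl.

Lemma ud_classZ r f : r *: ud_class f = ud_class (tscale r f).
Proof. exact: ud_scaleE. Qed.

End Hom.

Definition ud_id m : ud_hom m m := ud_class (tid (ud m)).

Definition ud_comp m l k (f : ud_hom l k) (g : ud_hom m l) : ud_hom m k :=
  ud_class (repr f ** repr g).

Definition ud_otimes m l m' l' (f : ud_hom m l) (g : ud_hom m' l') :
    ud_hom (m + m') (l + l') :=
  ud_class (ud_tens (repr f) (repr g)).

Lemma ud_compE m l k (f : term (ud l) (ud k)) (g : term (ud m) (ud l)) :
  ud_comp (ud_class f) (ud_class g) = ud_class (f ** g).
Proof. by apply/ud_classP/hteq_comp; exact: hteq_repr. Qed.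

Lemma ud_otimesE m l m' l' (f : term (ud m) (ud l))
    (g : term (ud m') (ud l')) :
  ud_otimes (ud_class f) (ud_class g) = ud_class (ud_tens f g).
Proof. by apply/ud_classP/hteq_tens; exact: hteq_repr. Qed.

Definition Psi_mu : term (ud 2) (ud 1) := 1_u ## gd' ## 1_d.
Definition Psi_delta : term (ud 1) (ud 2) := 1_u ## gc ## 1_d.
Definition Psi_eta : term (ud 0) (ud 1) := gc'.
Definition Psi_eps : term (ud 1) (ud 0) := gd.
Definition Psi_s : term (ud 2) (ud 2) :=
  tadd ((1_u ## mr ## 1_d) ** (gX ## mY) ** (1_u ## ml ## 1_d))
       (1_u ## (gc ** gd') ## 1_d).

End Heisenberg.

(* Strict linear monoidal functors from Par(t) to H_ud(t) given on objects by
   k |-> [ud k]. *)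
Record ud_functor (R : comPzRingType) (t : R) := UdFunctor {
  fhom :> forall m l, {linear par_hom R m l -> ud_hom t m l};
  fhom_id : forall m, fhom m m (par_id R m) = ud_id t m;
  fhom_comp : forall m l k (f : par_hom R l k) (g : par_hom R m l),
    fhom m k (par_comp t f g) = ud_comp (fhom l k f) (fhom m l g);
  fhom_tens : forall m l m' l' (f : par_hom R m l) (g : par_hom R m' l'),
    fhom (m + m') (l + l') (par_tens f g) =
      ud_otimes (fhom m l f) (fhom m' l' g)
}.

(* Par(t) is generated by these five diagrams, so Psi_t is the only functor with
   these values. *)
Record is_Psi (R : comPzRingType) (t : R) (Psi : ud_functor t) : Prop := {
  is_Psi_mu : Psi 2 1 (par_diag R (one_block 2 1)) = ud_class t (Psi_mu R);
  is_Psi_delta :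
    Psi 1 2 (par_diag R (one_block 1 2)) = ud_class t (Psi_delta R);
  is_Psi_eta : Psi 0 1 (par_diag R (one_block 0 1)) = ud_class t (Psi_eta R);
  is_Psi_eps : Psi 1 0 (par_diag R (one_block 1 0)) = ud_class t (Psi_eps R);
  is_Psi_s : Psi 2 2 (par_diag R swap) = ud_class t (Psi_s R)
}.

Definition is_faithful (R : comPzRingType) (t : R) (F : ud_functor t) : Prop :=
  forall m l, injective (F m l).

(* Main.v *)
(* H acts on the modules of a "symmetric group of rank t": an upward strand is
   induction, a downward strand is restriction, and one evaluates at the trivial
   module, where (Up Dn)^k gives the functions on the k-th power of a set of size
   t. For arbitrary t in R this set is modelled by nat, functions being fixed by
   the transpositions beyond some bound and sums over the set being replaced by
   the integral for which points have measure 1 and the whole set has measure t;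
   Fubini's theorem for such functions makes cups and caps natural. In this
   representation Psi sends a partition to the operator on functions whose kernel
   is the indicator of the tuples constant on its blocks, and these operators are
   linearly independent, being unitriangular for refinement of partitions. *)
From mathcomp Require Import all_boot all_order all_algebra.
From mathcomp Require Import boolp zify ring.
Require Import Defs.

Set Implicit Arguments.
Unset Strict Implicit.
Unset Printing Implicit Defensive.

Import GRing.Theory.
Local Open Scope ring_scope.

(** * Integration of eventually constant functions *)

(** The relations of H have to be checked for words of any shape, so all states are functions on one
    type of streams, and a term becomes an operator that also depends on the word to its right and
    on the size tau of the set to its left; each [Up] passed lowers tau by one and each [Dn] raises
    it. The interchange law then says that the operators are natural, and its delicate case is the
    integral, which is natural at itself by Fubini. The clockwise bubble acts by the current size
    tau. This is t after every word [ud n], which is why the relation with t is sound in H_ud. As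
    Psi is known on generators only, a diagram m -> l is factored without loops: create l strands,
    impose an equivalence relation on l + m parallel strands, erase the m old ones. Since [nat] is
    infinite, the blocks of a diagram D0 can carry distinct values, and the kernel entry of D at
    this point is 1 if D is finer than D0 and 0 otherwise, over any ring. *)

Definition stream := nat -> nat.
Definition scons (i : nat) (x : stream) : stream :=
  fun n => if n is n'.+1 then x n' else i.
Definition stl (x : stream) : stream := fun n => x n.+1.

Lemma scons_eta x : scons (x 0%N) (stl x) = x.
Proof. by apply: funext; case. Qed.

Definition adj (k i : nat) : nat :=
  if i == k then k.+1 else if i == k.+1 then k else i.

Lemma adjK k : involutive (adj k).
Proof. rewrite /adj => i; repeat case: ifP => /eqP; lia. Qed.

Section Integral.
Variable R : comPzRingType.
Implicit Types (f g : nat -> R) (tau : R).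

Definition evconst f := exists N, forall i, (N <= i)%N -> f i = f N.

(* Integral of an eventually constant function over a set of total measure
   [tau] in which every element of [nat] has measure one; zero for other
   functions. *)
Definition integ tau f : R :=
  match pselect (evconst f) with
  | left h => let N := projT1 (cid h) in
      \sum_(i < N) f i + (tau - N%:R) * f N
  | right _ => 0
  end.

Lemma integE tau f N : (forall i, (N <= i)%N -> f i = f N) ->
  integ tau f = \sum_(i < N) f i + (tau - N%:R) * f N.
Proof.
move=> fN; rewrite /integ; case: pselect => [h|[]]; last by exists N.
case: (cid h) => /= M fM.
(* The cutoff may be moved outwards: values of [f] pass from the tail term to the sum. *)
have main a b : (forall i, (a <= i)%N -> f i = f a) ->
   \sum_(i < a + b) f i + (tau - (a + b)%:R) * f (a + b)%N =
   \sum_(i < a) f i + (tau - a%:R) * f a.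
  move=> fa; elim: b => [|b IH]; first by rewrite addn0.
  rewrite addnS big_ord_recr /= -IH !(fa (_ + _)%N) ?(fa (_ + _).+1) ?leq_addr //.
    by rewrite -addn1 natrD; ring.
  lia.
case: (leqP M N) => h'.
  by rewrite -(main _ (N - M)%N fM) subnKC.
by rewrite -(main _ (M - N)%N fN) subnKC // ltnW.
Qed.

Lemma integ_lin tau a f g : evconst f -> evconst g ->
  integ tau (fun i => a * f i + g i) = a * integ tau f + integ tau g.
Proof.
case=> N fN [M gM].
have fNM i : (N + M <= i)%N -> f i = f (N + M)%N.
  by move=> hi; rewrite !(fN i) ?(fN (N + M)%N) //; lia.
have gNM i : (N + M <= i)%N -> g i = g (N + M)%N.
  by move=> hi; rewrite !(gM i) ?(gM (N + M)%N) //; lia.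
rewrite (integE _ fNM) (integE _ gNM) (@integE _ _ (N + M)); last first.
  by move=> i hi; rewrite fNM ?gNM.
rewrite big_split /= -mulr_sumr; ring.
Qed.

Lemma integ_cst tau c : integ tau (fun=> c) = tau * c.
Proof. by rewrite (@integE _ _ 0) // big_ord0 add0r subr0. Qed.

Lemma integ_point tau k f : (forall i, i != k -> f i = 0) -> integ tau f = f k.
Proof.
move=> f0; rewrite (@integE _ _ k.+1) => [|i hi]; last by rewrite !f0 //; lia.
rewrite big_ord_recr /= big1 => [|i _]; last by rewrite f0 // neq_ltn ltn_ord.
by rewrite (f0 k.+1) ?mulr0 ?addr0 ?add0r //; lia.
Qed.

(** The point k has measure one, and [bump k] renumbers the others, whose total measure is tau - 1.
    This is the source of the shift of tau at each [Up]. *)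
Lemma integ_bump tau k f : evconst f ->
  integ tau f = f k + integ (tau - 1) (f \o bump k).
Proof.
case=> N fN.
have fM i : (k + N <= i)%N -> f i = f (k + N)%N.
  by move=> hi; rewrite (fN i) ?(fN (k + N)%N) //; lia.
rewrite (@integE _ f (k + N).+1) => [|i hi]; last first.
  by rewrite (fM i) ?(fM (_).+1) //; lia.
rewrite (@integE _ _ (k + N)) => [|i hi] /=; last first.
  by rewrite !(fM (bump _ _)) // /bump; lia.
have hk : (k < (k + N).+1)%N by lia.
rewrite (bigD1_ord (Ordinal hk)) //= -addrA; congr (_ + (_ + _)).
rewrite (fM (_).+1) ?leqnSn // (fM (bump _ _)); last by rewrite /bump; lia.
by rewrite -addn1 natrD; ring.
Qed.

Lemma evconst_adj f N : (forall k, (N <= k)%N -> f k = f k.+1) -> evconst f.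
Proof.
move=> h; exists N => i; elim: i => [|i IH]; first by rewrite leqn0 => /eqP ->.
rewrite leq_eqVlt => /orP[/eqP -> //|]; rewrite ltnS => hi.
by rewrite -h // IH.
Qed.

Lemma integ_adj tau k f : evconst f -> integ tau (f \o adj k) = integ tau f.
Proof.
case=> N fN; set M := (N + k.+2)%N.
have fM i : (M <= i)%N -> f i = f M.
  by move=> hi; rewrite (fN i) ?(fN M) // /M; lia.
have adjM i : (M <= i)%N -> adj k i = i.
  by rewrite /adj /M => hi; repeat case: ifP => /eqP; lia.
rewrite (integE _ fM) (@integE _ _ M) => [|i hi] /=; last first.
  by rewrite !adjM // fM.
rewrite adjM //; congr (_ + _).
have adjL i : (i < M)%N -> (adj k i < M)%N.
  by rewrite /adj /M => hi; repeat case: ifP => /eqP; lia.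
pose h (i : 'I_M) := Ordinal (adjL i (ltn_ord i)).
rewrite [RHS](reindex_inj (h := h)) //.
by apply: (can_inj (g := h)) => i; apply: val_inj; rewrite /= adjK.
Qed.

(* Invariance under the symmetric group of the elements beyond some bound makes
   the value off the diagonal constant at infinity, hence Fubini. *)
Lemma integ_fubini tau (f : nat -> nat -> R) N :
  (forall k a b, (N <= k)%N -> f (adj k a) (adj k b) = f a b) ->
  integ tau (fun a => integ tau (f a)) =
  integ tau (fun b => integ tau (f^~ b)).
Proof.
move=> inv.
have adjlt k a : (a < k)%N -> adj k a = a.
  by rewrite /adj; repeat case: ifP => /eqP; lia.
have adjgt k a : (k.+1 < a)%N -> adj k a = a.
  by rewrite /adj; repeat case: ifP => /eqP; lia.
have adjl k : adj k k = k.+1 by rewrite /adj eqxx.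
have adjr k : adj k k.+1 = k by rewrite /adj eqxx; case: ifP => /eqP; lia.
(* By the invariance, outside the finite square [f] has one value per row, one per column, [f N N]
   on the diagonal and [f N N.+1] off it. *)
have fr a b : (a < N)%N -> (N <= b)%N -> f a b = f a N.
  move=> ha; elim: b => [|b IH]; first by rewrite leqn0 => /eqP ->.
  rewrite leq_eqVlt => /orP[/eqP -> //|]; rewrite ltnS => hb.
  by rewrite -IH // -(inv b) // adjr adjlt //; lia.
have fl a b : (a < N)%N -> (N <= b)%N -> f b a = f N a.
  move=> ha; elim: b => [|b IH]; first by rewrite leqn0 => /eqP ->.
  rewrite leq_eqVlt => /orP[/eqP -> //|]; rewrite ltnS => hb.
  by rewrite -IH // -(inv b) // adjr adjlt //; lia.
have fd a : (N <= a)%N -> f a a = f N N.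
  elim: a => [|b IH]; first by rewrite leqn0 => /eqP ->.
  rewrite leq_eqVlt => /orP[/eqP -> //|]; rewrite ltnS => hb.
  by rewrite -IH // -(inv b) // adjr.
have flt a b : (N <= a)%N -> (a < b)%N -> f a b = f N N.+1.
  elim: a b => [|a IH] b.
    rewrite leqn0 => /eqP N0; rewrite N0 in inv *.
    elim: b => [//|b IHb _]; case: b IHb => // b IHb.
    by rewrite -IHb // -(inv b.+1) // adjr adjlt.
  rewrite leq_eqVlt => /orP[/eqP Na|].
    rewrite Na; elim: b => // b IHb; rewrite ltnS leq_eqVlt => /orP[/eqP <- //|hb].
    by rewrite -IHb // -(inv b) ?adjr ?adjlt //; lia.
  by rewrite ltnS => hN hb; rewrite -(IH b hN) 1?ltnW // -(inv a) // adjr adjgt.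
have fgt a b : (N <= b)%N -> (b < a)%N -> f a b = f N N.+1.
  move=> hb hba; have -> : f a b = f b.+1 b.
    elim: a hba => // a IHa; rewrite ltnS leq_eqVlt => /orP[/eqP <- //|h].
    by rewrite -IHa // -(inv a) ?adjr ?adjlt //; lia.
  by rewrite -(inv b) // adjl adjr flt.
pose c := f N N.+1.
have E1 a : (a < N)%N ->
    integ tau (f a) = \sum_(b < N) f a b + (tau - N%:R) * f a N.
  by move=> ha; rewrite (@integE _ _ N) // => i hi; rewrite fr.
have E1' a : (a < N)%N ->
    integ tau (f^~ a) = \sum_(b < N) f b a + (tau - N%:R) * f N a.
  by move=> ha; rewrite (@integE _ _ N) // => i hi; rewrite fl.
(* This row meets the diagonal at a, so it need not be constant from N on; once the point a is
   removed, the remainder is. *)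
have E2 a : (N <= a)%N ->
    integ tau (f a) = \sum_(b < N) f N b + f N N + (tau - N%:R - 1) * c.
  move=> ha.
  rewrite (integ_bump _ a); last first.
    by exists a.+1 => i hi; rewrite !flt //; lia.
  rewrite (@integE _ _ N) /= => [|i hi]; last first.
    have aux j : (N <= j)%N -> f a (bump a j) = c.
      rewrite /bump => hj; case: leqP => hh; first by rewrite flt //; lia.
      by rewrite fgt.
    by rewrite !aux.
  have -> : f a (bump a N) = c.
    by rewrite /bump; case: leqP => hh; [rewrite flt //; lia | rewrite fgt].
  rewrite fd //.
  have -> : \sum_(i < N) f a (bump a i) = \sum_(i < N) f N i.
    apply: eq_bigr => i _; rewrite -(fl i a) //; congr f.
    by rewrite /bump; have := ltn_ord i; lia.
  ring.
have E2' a : (N <= a)%N ->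
    integ tau (f^~ a) = \sum_(b < N) f b N + f N N + (tau - N%:R - 1) * c.
  move=> ha.
  rewrite (integ_bump _ a); last first.
    by exists a.+1 => i hi; rewrite !fgt //; lia.
  rewrite (@integE _ _ N) /= => [|i hi]; last first.
    have aux j : (N <= j)%N -> f (bump a j) a = c.
      rewrite /bump => hj; case: leqP => hh; first by rewrite fgt //; lia.
      by rewrite flt.
    by rewrite !aux.
  have -> : f (bump a N) a = c.
    by rewrite /bump; case: leqP => hh; [rewrite fgt //; lia | rewrite flt].
  rewrite fd //.
  have -> : \sum_(i < N) f (bump a i) a = \sum_(i < N) f i N.
    apply: eq_bigr => i _; rewrite -(fr i a) //; congr f.
    by rewrite /bump; have := ltn_ord i; lia.
  ring.
rewrite (@integE _ (fun a => _) N) => [|i hi]; last by rewrite !E2.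
rewrite [RHS](@integE _ _ N) => [|i hi]; last by rewrite !E2'.
rewrite E2 // E2' //.
rewrite (eq_bigr _ (fun (i : 'I_N) _ => E1 i (ltn_ord i))).
rewrite [in RHS](eq_bigr _ (fun (i : 'I_N) _ => E1' i (ltn_ord i))).
rewrite !big_split /= exchange_big /= -!mulr_sumr; ring.
Qed.

End Integral.

(** * States and the action of transpositions *)

Definition state (R : comPzRingType) := stream -> R.
Definition comp_at R (phi : state R) i : state R := fun x => phi (scons i x).
Definition pack R (F : nat -> state R) : state R := fun x => F (x 0%N) (stl x).

Local Notation "phi .@ i" := (comp_at phi i) (at level 2, left associativity,
  format "phi .@ i").

Section Action.
Variable R : comPzRingType.
Local Notation state := (state R).
Implicit Types (phi psi : state) (w p q : seq arrow).

Lemma packE (F : nat -> state) i : (pack F).@i = F i.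
Proof. by []. Qed.

Lemma pack_app (F : nat -> state) x : pack F x = F (x 0%N) (stl x). Proof. by []. Qed.
Lemma comp_at_app phi i x : phi.@i x = phi (scons i x). Proof. by []. Qed.

Lemma stateP phi psi : (forall i, phi.@i = psi.@i) -> phi = psi.
Proof.
move=> h; apply: funext => x; rewrite -(scons_eta x).
by move/(congr1 (@^~ (stl x))): (h (x 0%N)).
Qed.

Lemma comp_atK phi : pack (comp_at phi) = phi.
Proof. exact: stateP. Qed.

(* In a state over the word [w], read from the left, each [Up] chooses an element
   of the current set and removes it, and each [Dn] adds a new element; the
   current set is always renumbered increasingly by [nat], the new element being
   0. The choices are read off a stream, whose remaining entries are junk.
   [sigma k w] renames k and k + 1 in the initial set. *)
Fixpoint sigma (k : nat) w (x : stream) : stream :=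
  match w with
  | [::] => x
  | Dn :: w' => sigma k.+1 w' x
  | Up :: w' =>
      scons (adj k (x 0%N))
        (if (x 0%N == k) || (x 0%N == k.+1) then stl x
         else sigma (if (x 0%N < k)%N then k.-1 else k) w' (stl x))
  end.

Definition sw k w phi : state := fun x => phi (sigma k w x).

Lemma sw_dn k w phi : sw k (Dn :: w) phi = sw k.+1 w phi. Proof. by []. Qed.

Lemma sw_upl k w phi i : (i < k)%N ->
  (sw k (Up :: w) phi).@i = sw k.-1 w phi.@i.
Proof.
move=> h; apply: funext => x; rewrite /sw /comp_at /= /adj h.
by rewrite !ifN //; lia.
Qed.

(** Once k or k + 1 has been chosen, only one of the two remains and it is numbered k in both cases,
    so nothing is left to exchange. *)
Lemma sw_upk k w phi : (sw k (Up :: w) phi).@k = phi.@(k.+1).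
Proof. by apply: funext => x; rewrite /sw /comp_at /= /adj eqxx. Qed.

Lemma sw_upS k w phi : (sw k (Up :: w) phi).@(k.+1) = phi.@k.
Proof.
apply: funext => x; rewrite /sw /comp_at /= /adj eqxx orbT.
by rewrite ifN //; lia.
Qed.

Lemma sw_upr k w phi i : (k.+1 < i)%N ->
  (sw k (Up :: w) phi).@i = sw k w phi.@i.
Proof.
move=> h; apply: funext => x; rewrite /sw /comp_at /= /adj.
by rewrite !ifN //; lia.
Qed.

Variant sw_up_spec k w phi i : state -> Prop :=
| SwUpL of (i < k)%N : sw_up_spec k w phi i (sw k.-1 w phi.@i)
| SwUpK of i = k : sw_up_spec k w phi i phi.@(k.+1)
| SwUpS of i = k.+1 : sw_up_spec k w phi i phi.@k
| SwUpR of (k.+1 < i)%N : sw_up_spec k w phi i (sw k w phi.@i).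

Lemma sw_upP k w phi i : sw_up_spec k w phi i (sw k (Up :: w) phi).@i.
Proof.
case: (ltngtP i k) => [h|h|->]; first by rewrite sw_upl //; constructor.
  case: (ltngtP i k.+1) => [|h'|->]; first by lia.
    by rewrite sw_upr //; constructor.
  by rewrite sw_upS; constructor.
by rewrite sw_upk; constructor.
Qed.

Definition vlin (a : R) phi psi : state := fun x => a * phi x + psi x.
Definition vzero : state := fun=> 0.

Lemma vlin_at a phi psi i : (vlin a phi psi).@i = vlin a phi.@i psi.@i.
Proof. by []. Qed.
Lemma vzero_at i : (vzero : state).@i = vzero. Proof. by []. Qed.
Lemma sw_vzero k w : sw k w vzero = vzero. Proof. by []. Qed.
Lemma vlinN phi : vlin (-1) phi phi = vzero.
Proof. by apply: funext => x; rewrite /vlin mulN1r addNr. Qed.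

Definition smooth w phi := exists K, forall k, (K <= k)%N -> sw k w phi = phi.

Lemma smooth_zero w : smooth w vzero.
Proof. by exists 0%N. Qed.

Lemma smooth_dn w phi : smooth (Dn :: w) phi <-> smooth w phi.
Proof.
split=> -[K h]; exists K.+1 => k hk; last by rewrite sw_dn h //; lia.
by case: k hk => // k hk; rewrite -sw_dn h.
Qed.

(** A word reads finitely many entries of x, and transpositions far beyond these do nothing. The
    bound depends on the point and not on a state; together with smoothness it makes integrands
    eventually constant. *)
Lemma sigma_far w x : exists B, forall k, (B <= k)%N -> sigma k w x = x.
Proof.
elim: w x => [|[] w IH] x; first by exists 0%N.
  have [B hB] := IH (stl x); exists (x 0 + B.+2)%N => k hk; rewrite /= /adj.
  have -> : (x 0 == k)%N = false by lia.
  have -> : (x 0 == k.+1)%N = false by lia.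
  have -> /= : (x 0 < k)%N by lia.
  by rewrite hB ?scons_eta //; lia.
by have [B hB] := IH x; exists B => k hk /=; rewrite hB //; lia.
Qed.

(* [gam w i] and [gami w i] act by the cycle of 0, ..., i which compares the
   numbering of a set with its numbering after i was replaced by a new 0. *)
Fixpoint gam w i phi : state :=
  if i is j.+1 then gam w j (sw j w phi) else phi.
Fixpoint gami w i phi : state :=
  if i is j.+1 then sw j w (gami w j phi) else phi.

(** A precomposition commutes with all pointwise operations on states, such as linear combinations
    and integrals. *)
Lemma gami_pre w i : exists s : stream -> stream, forall phi, gami w i phi = phi \o s.
Proof.
elim: i => [|i [s IH]]; first by exists id.
by exists (s \o sigma i w) => phi /=; rewrite IH.
Qed.

Opaque sw comp_at pack.

(** With [sw_far] and [sw_braid], these are the Coxeter relations of the adjacent transpositions. *)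
Lemma swK k w : involutive (sw k w).
Proof.
elim: w k => [//|[] w IH] k phi; last exact: IH.
apply: stateP => i; case: sw_upP => [h|->|->|h].
- by rewrite sw_upl // IH.
- by rewrite sw_upS.
- by rewrite sw_upk.
- by rewrite sw_upr // IH.
Qed.

Lemma sw_far k j w phi : (k.+1 < j)%N ->
  sw k w (sw j w phi) = sw j w (sw k w phi).
Proof.
elim: w k j phi => [//|[] w IH] k j phi h; last by rewrite !sw_dn IH.
apply: stateP => i.
case: sw_upP => [h1|->|->|h1].
- by rewrite !sw_upl 1?IH //; lia.
- by rewrite sw_upl // (@sw_upl j) ?sw_upk //; lia.
- by rewrite (@sw_upl j) ?(@sw_upl j) ?sw_upS //; lia.
case: sw_upP => [h2|->|->|h2].
- by rewrite sw_upl // sw_upr // IH //; lia.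
- by rewrite sw_upk sw_upr //; lia.
- by rewrite sw_upS sw_upr //; lia.
- by rewrite !sw_upr 1?IH //; lia.
Qed.

Lemma sw_braid k w phi :
  sw k w (sw k.+1 w (sw k w phi)) = sw k.+1 w (sw k w (sw k.+1 w phi)).
Proof.
elim: w k phi => [//|[] w IH] k phi; last by rewrite !sw_dn IH.
apply: stateP => i.
case: (ltngtP i k) => [h|h|->].
- rewrite (@sw_upl k) // (@sw_upl k.+1) 1?(@sw_upl k) //; try lia.
  rewrite [in RHS](@sw_upl k.+1) 1?(@sw_upl k) 1?(@sw_upl k.+1) //; try lia.
  by case: k h => // k h; exact: IH.
- case: (ltngtP i k.+2) => [h'|h'|->].
  + have -> : i = k.+1 by lia.
    by rewrite sw_upS (@sw_upl k.+1) // sw_upk sw_upk sw_upr // sw_upS.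
  + by rewrite !sw_upr 1?IH //; lia.
  + by rewrite (@sw_upr k) // sw_upS sw_upS sw_upS sw_upS (@sw_upl k.+1).
- by rewrite sw_upk sw_upk sw_upr // (@sw_upl k.+1) // sw_upk sw_upk.
Qed.

Lemma gamK w i : cancel (gam w i) (gami w i).
Proof. by elim: i => //= i IH phi; rewrite IH swK. Qed.
Lemma gamiK w i : cancel (gami w i) (gam w i).
Proof. by elim: i => //= i IH phi; rewrite swK IH. Qed.

Lemma smooth_at w phi i : smooth (Up :: w) phi -> smooth w phi.@i.
Proof.
case=> K h; exists (K + i.+1)%N => k hk.
by rewrite -{2}(h k.+1) ?sw_upl //; lia.
Qed.

Lemma smooth_sw w phi k : smooth w phi -> smooth w (sw k w phi).
Proof.
case=> K h; exists (K + k.+2)%N => j hj.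
by rewrite -sw_far 1?h //; lia.
Qed.

Lemma smooth_gami w i phi : smooth w phi -> smooth w (gami w i phi).
Proof. by elim: i => //= i IH /IH; exact: smooth_sw. Qed.

Lemma sw_gami_lt k w i phi : (i < k)%N ->
  gami w i (sw k w phi) = sw k w (gami w i phi).
Proof. by elim: i => //= i IH h; rewrite IH 1?sw_far //; lia. Qed.

(** Conjugation by the cycle, which sends 0 to i and lowers 1, ..., i by one. *)
Lemma sw_gami_gt k w i phi : (k.+1 < i)%N ->
  gami w i (sw k.+1 w phi) = sw k w (gami w i phi).
Proof.
elim: i => //= i IH; rewrite ltnS leq_eqVlt => /orP[/eqP <-|h] /=.
  by rewrite sw_gami_lt // sw_braid.
by rewrite IH // -sw_far //; lia.
Qed.

(** The cycle puts the chosen element back in its place and so undoes the renumbering: the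
    transposition then acts separately on the choice and on the rest of the state. *)
Lemma gami_sw k p i phi :
  gami p i (sw k [:: Up, Dn & p] phi).@i =
  sw k p (gami p (adj k i) phi.@(adj k i)).
Proof.
case: sw_upP => [h|->|->|h].
- rewrite /adj !ifN; try lia. rewrite sw_dn prednK; last by lia. by rewrite sw_gami_lt.
- by rewrite /adj eqxx /= swK.
- by rewrite /adj eqxx ifN //; lia.
- by rewrite /adj !ifN ?sw_dn 1?sw_gami_gt //; lia.
Qed.

(** If the strand picks the restored element a, it picks the new element 0 in the other numbering.
    Otherwise a and b are each renumbered by the removal of the other, and [.+1] makes room for the
    new element. *)
Lemma gami_up p a phi b : (gami (Up :: p) a phi).@b =
  if a == b then phi.@0 else gami p (unbump b a) phi.@(unbump a b).+1.
Proof.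
elim: a b => [|a IH] b /=.
  by case: b => [|b] //=; rewrite /unbump /= subn1.
case: sw_upP => [h|->|->|h]; rewrite IH.
- have [->] : (a == b) = false /\ (a.+1 == b) = false by lia.
  move=> ->; have -> : unbump b a = a.-1 by rewrite /unbump; lia.
  have -> : unbump b a.+1 = a.-1.+1 by rewrite /unbump; lia.
  by rewrite /=; congr (sw _ _ (gami _ _ _.@_)); rewrite /unbump; lia.
- have [->] : (a == a.+1) = false /\ (a.+1 == a) = false by lia.
  by move=> ->; congr (gami _ _ _.@_); rewrite /unbump; lia.
- by rewrite !eqxx.
- have [->] : (a == b) = false /\ (a.+1 == b) = false by lia.
  move=> ->; have -> : unbump b a = a by rewrite /unbump; lia.
  have -> : unbump b a.+1 = a.+1 by rewrite /unbump; lia.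
  by rewrite /=; congr (sw _ _ (gami _ _ _.@_)); rewrite /unbump; lia.
Qed.

(** Over [Dn :: p] all indices are shifted by one, so the cycle there is the next longer one
    stripped of its first transposition. *)
Lemma gami_dn p i phi : gami (Dn :: p) i (sw 0 p phi) = gami p i.+1 phi.
Proof. by elim: i => [|i IH] //=; rewrite sw_dn IH. Qed.

(* [bump] and [unbump] translate between the numberings of a set before and after
   the removal of one element. *)
Definition vX phi : state := pack (fun i => pack (fun j =>
  phi.@(bump i j).@(unbump (bump i j) i))).
(** The cup [vc] forces the choice of the element just added, which is 0. In [vd] and [vc'] the
    chosen element is replaced by a new one, and [gami] and [gam] translate between the two
    numberings; apart from this, [vd] integrates over the choice and [vc'] is constant in it. *)
Definition vc phi : state := pack (fun i => if i is 0 then phi else vzero).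
Definition vd (r : seq arrow) (tau : R) phi : state :=
  fun x => integ tau (fun i => gami r i phi.@i x).
Definition vc' (r : seq arrow) phi : state := pack (fun i => gam r i phi).

Lemma vX_at phi i j a b : a = bump i j -> b = unbump a i ->
  (vX phi).@i.@j = phi.@a.@b.
Proof. by move=> -> ->; rewrite /vX !packE. Qed.

Lemma vX_sw k p phi :
  vX (sw k [:: Up, Up & p] phi) = sw k [:: Up, Up & p] (vX phi).
Proof.
apply: stateP => i; apply: stateP => j.
have [a ea] : exists a, a = bump i j by eexists.
have [b eb] : exists b, b = unbump a i by eexists.
rewrite (vX_at _ ea eb); rewrite /bump /unbump in ea eb.
case: (sw_upP k _ phi a) => [h1|h1|h1|h1];
case: (sw_upP k _ (vX phi) i) => [h2|h2|h2|h2];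
  try (exfalso; lia);
  try (case: (sw_upP _ _ phi.@a b) => [h3|h3|h3|h3]; try (exfalso; lia));
  try (case: (sw_upP _ _ (vX phi).@i j) => [h4|h4|h4|h4]; try (exfalso; lia));
  rewrite /vX ?packE;
  first [ by congr (_.@_.@_); rewrite /bump /unbump; lia
        | by congr (sw _ _ _.@_.@_); rewrite /bump /unbump; lia].
Qed.
End Action.

(** * Natural operators *)

Section Operators.
Variable R : comPzRingType.
Local Notation state := (state R).
Implicit Types (phi psi : state) (w p q r : seq arrow) (tau : R).

Lemma gami_vlin w i a phi psi :
  gami w i (vlin a phi psi) = vlin a (gami w i phi) (gami w i psi).
Proof. by have [s h] := gami_pre R w i; rewrite !h. Qed.

Lemma vd_evconst p phi x : smooth [:: Up, Dn & p] phi ->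
  evconst (fun i => gami p i phi.@i x).
Proof.
case=> K hK; have [B hB] := sigma_far p x.
apply: (@evconst_adj _ _ (K + B)) => k hk.
rewrite -{1}(hK k) ?gami_sw; last by lia.
by rewrite /adj eqxx /sw hB //; lia.
Qed.

Lemma vd_lin p tau a phi psi :
  smooth [:: Up, Dn & p] phi -> smooth [:: Up, Dn & p] psi ->
  vd p tau (vlin a phi psi) = vlin a (vd p tau phi) (vd p tau psi).
Proof.
move=> hf hp; apply: funext => x; rewrite /vd /vlin -integ_lin; last 2 first.
- exact: vd_evconst.
- exact: vd_evconst.
by congr integ; apply: funext => i; rewrite -/(vlin a phi psi) vlin_at gami_vlin.
Qed.

Lemma vd_zero p tau : vd p tau (@vzero R) = @vzero R.
Proof. by rewrite -(vlinN (vzero R)) vd_lin ?vlinN //; exact: smooth_zero. Qed.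

Definition equivariant p q (T : state -> state) :=
  forall k phi, smooth p phi -> T (sw k p phi) = sw k q (T phi).

Lemma equivariant_smooth p q T phi :
  equivariant p q T -> smooth p phi -> smooth q (T phi).
Proof. by move=> hT [K h]; exists K => k hk; rewrite -hT ?h //; exists K. Qed.

Lemma equivariant_gami p q T phi i : equivariant p q T -> smooth p phi ->
  gami q i (T phi) = T (gami p i phi).
Proof.
move=> hT hf; elim: i => //= i ->; rewrite hT //; exact: smooth_gami.
Qed.

Lemma equivariant_dn p q T :
  equivariant p q T -> equivariant (Dn :: p) (Dn :: q) T.
Proof. by move=> hT k phi /smooth_dn h; rewrite !sw_dn hT. Qed.

Lemma equivariant_up p q T : equivariant p q T ->
  equivariant (Up :: p) (Up :: q) (fun phi => pack (fun i => T phi.@i)).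
Proof.
move=> hT k phi h; apply: stateP => i; rewrite packE.
case: (sw_upP k q (pack _) i) => [hi|->|->|hi]; rewrite packE.
- by rewrite sw_upl // hT //; exact: smooth_at.
- by rewrite sw_upk.
- by rewrite sw_upS.
- by rewrite sw_upr // hT //; exact: smooth_at.
Qed.

(** By [gami_sw] a transposition permutes the variable of integration, and the integral is invariant
    under this. *)
Lemma vd_equivariant p tau : equivariant [:: Up, Dn & p] p (vd p tau).
Proof.
move=> k phi h; apply: funext => x.
have -> : sw k p (vd p tau phi) x =
   integ tau (fun i => gami p i phi.@i (sigma k p x)) by [].
rewrite -(integ_adj _ k); last exact: vd_evconst.
by congr integ; apply: funext => i; rewrite gami_sw.
Qed.

Definition operator := R -> state -> state.

(* The last condition is the naturality of [vd] at [T]; since [vd] is given by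
   the integral it does not follow from linearity and equivariance. *)
Record good p q (T : operator) : Prop := Good {
  good_lin : forall tau a phi psi, smooth p phi -> smooth p psi ->
    T tau (vlin a phi psi) = vlin a (T tau phi) (T tau psi);
  good_eqv : forall tau, equivariant p q (T tau);
  good_vd : forall tau phi, smooth [:: Up, Dn & p] phi ->
    vd q tau (pack (fun i => T tau phi.@i)) = T tau (vd p tau phi)
}.

Lemma good_zero p q T tau : good p q T -> T tau (vzero R) = vzero R.
Proof.
move=> hT; rewrite -(vlinN (vzero R)) (good_lin hT) ?vlinN //; exact: smooth_zero.
Qed.

Lemma good_smooth p q T tau phi : good p q T -> smooth p phi -> smooth q (T tau phi).
Proof. by move=> /good_eqv h; exact: equivariant_smooth. Qed.

Lemma good_smooth_updn p q T tau phi : good p q T -> smooth [:: Up, Dn & p] phi ->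
  smooth [:: Up, Dn & q] (pack (fun i => T tau phi.@i)).
Proof.
move=> /good_eqv h; exact: equivariant_smooth (equivariant_up (equivariant_dn (h tau))).
Qed.

Lemma good_id p : good p p (fun _ phi => phi).
Proof. by split=> // tau phi _; rewrite comp_atK. Qed.

Lemma good_null p q : good p q (fun _ _ => vzero R).
Proof.
split=> [tau a phi psi _ _|tau k phi _|tau phi _] //.
  by apply: funext => x; rewrite /vlin /vzero mulr0 addr0.
by rewrite -[in RHS](vd_zero q tau).
Qed.

Lemma good_comp p q r T U : good q r U -> good p q T ->
  good p r (fun tau phi => U tau (T tau phi)).
Proof.
move=> hU hT; split=> [tau a phi psi h1 h2|tau k phi h|tau phi h].
- by rewrite (good_lin hT) // (good_lin hU) //; apply: (good_smooth _ hT).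
- by rewrite (good_eqv hT) // (good_eqv hU) //; apply: (good_smooth _ hT).
- rewrite -(good_vd hT) // -(good_vd hU) //.
  exact: good_smooth_updn h.
Qed.

Lemma good_vlin p q a T U : good p q T -> good p q U ->
  good p q (fun tau phi => vlin a (T tau phi) (U tau phi)).
Proof.
move=> hT hU; split=> [tau b phi psi h1 h2|tau k phi h|tau phi h].
- rewrite (good_lin hT) // (good_lin hU) //; apply: funext => x; rewrite /vlin; ring.
- by rewrite (good_eqv hT) // (good_eqv hU).
- rewrite -(good_vd hT) // -(good_vd hU) // -vd_lin //.
    exact: good_smooth_updn h.
  exact: good_smooth_updn h.
Qed.

(* The part of [vd] over [Up :: p] in which the chosen element differs from the
   one chosen by the strand [Up]. *)
Definition vd_off phi k : state :=
  pack (fun a => phi.@(bump k a).@(unbump (bump k a) k).+1).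

(** The integral is split at i = k, where the second [Up] picks the element that [Dn] has just put
    back. The other points form a set of measure tau - 1, the size seen behind the strand. *)
Lemma vd_up p tau phi k : smooth [:: Up, Dn, Up & p] phi ->
  (vd (Up :: p) tau phi).@k =
  vlin 1 phi.@k.@0 (vd p (tau - 1) (vd_off phi k)).
Proof.
move=> hs; apply: funext => x.
have -> : (vd (Up :: p) tau phi).@k x =
    integ tau (fun i => gami (Up :: p) i phi.@i (scons k x)) by [].
rewrite (integ_bump _ k) /=; last exact: vd_evconst.
rewrite /vlin mul1r; congr (_ + _).
  by have := gami_up p k phi.@k k; rewrite eqxx => /(congr1 (@^~ x)).
congr integ; apply: funext => a /=.
have := gami_up p (bump k a) phi.@(bump k a) k.
rewrite eq_sym (negbTE (neq_bump _ _)) bumpK.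
by move/(congr1 (@^~ x)).
Qed.

Lemma vd_off_smooth p phi k : smooth [:: Up, Dn, Up & p] phi ->
  smooth [:: Up, Dn & p] (vd_off phi k).
Proof.
move=> h.
(* [vd_off phi k] is a component of [vX] applied after this map, which discards the choice of the
   new element; both maps are equivariant. *)
have hL : equivariant [:: Dn, Up & p] [:: Up, Dn & p]
    (fun psi => pack (fun j => psi.@j.+1)).
  move=> j psi _; apply: stateP => i; rewrite packE sw_dn.
  case: (sw_upP j _ (pack _) i) => [hi|->|->|hi]; rewrite ?packE ?sw_upk ?sw_upS //.
    by rewrite sw_upl // sw_dn prednK //; lia.
  by rewrite sw_upr.
have hX : equivariant [:: Up, Up, Dn & p] [:: Up, Up, Dn & p] (@vX R).
  by move=> j psi _; exact: vX_sw.
by have := smooth_at k (equivariant_smooth hX (equivariant_smooth (equivariant_up hL) h)).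
Qed.

Lemma good_up p q T : good p q T ->
  good (Up :: p) (Up :: q) (fun tau phi => pack (fun i => T (tau - 1) phi.@i)).
Proof.
move=> hT; split=> [tau a phi psi h1 h2|tau|tau phi h].
- apply: stateP => i; rewrite packE !vlin_at !packE (good_lin hT) //; exact: smooth_at.
- exact/equivariant_up/(good_eqv hT).
- apply: stateP => k; rewrite packE.
  have h' : smooth [:: Up, Dn, Up & q]
     (pack (fun i => pack (fun j => T (tau - 1) phi.@i.@j))).
    have hE := good_eqv hT (tau - 1).
    exact: equivariant_smooth (equivariant_up (equivariant_dn (equivariant_up hE))) h.
  rewrite (vd_up _ _ h') (vd_up _ _ h) !packE.
  have hx := vd_off_smooth k h.
  rewrite (good_lin hT) -?(good_vd hT) //.
    exact/smooth_at/smooth_dn/smooth_at.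
  exact: equivariant_smooth (vd_equivariant _) hx.
Qed.

(* Over [Dn :: p] the integral runs over all elements but the one added by the
   strand [Dn]. *)
Definition vd_shift p phi : state :=
  pack (fun i => if i is j.+1 then sw 0 p phi.@j else vzero R).

Lemma vd_shift_smooth p phi : smooth [:: Up, Dn, Dn & p] phi ->
  smooth [:: Up, Dn & p] (vd_shift p phi).
Proof.
case=> K hK; exists K.+1 => -[//|k] hk; rewrite -{2}(hK k) //.
apply: stateP => i; rewrite /vd_shift packE.
case: (sw_upP k.+1 _ (pack _) i) => [hi|->|->|hi]; rewrite packE.
- case: i hi => [//|i] hi; rewrite sw_upl // !sw_dn.
  case: k hk hi => // k hk hi /=; rewrite -sw_far //.
- by rewrite sw_upk.
- by rewrite sw_upS.
- by case: i hi => // i hi; rewrite sw_upr // !sw_dn -sw_far.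
Qed.

(** The element added by [Dn] raises the measure to tau + 1, but the integrand [vd_shift] vanishes
    there. *)
Lemma vd_dn p tau phi : smooth [:: Up, Dn, Dn & p] phi ->
  vd (Dn :: p) tau phi = vd p (tau + 1) (vd_shift p phi).
Proof.
move=> h; apply: funext => x; rewrite /vd.
rewrite [RHS](integ_bump _ 0); last by apply: vd_evconst; exact: vd_shift_smooth h.
rewrite addrK /= packE add0r; congr integ; apply: funext => i.
by rewrite -{1}(swK 0 p phi.@i) gami_dn.
Qed.

Lemma good_dn p q T : good p q T ->
  good (Dn :: p) (Dn :: q) (fun tau => T (tau + 1)).
Proof.
move=> hT; split=> [tau a phi psi /smooth_dn h1 /smooth_dn h2|tau|tau phi h].
- exact: good_lin hT _ _ _ _ h1 h2.
- exact/equivariant_dn/(good_eqv hT).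
- rewrite !vd_dn //; last first.
    have hE := good_eqv hT (tau + 1).
    exact: equivariant_smooth (equivariant_up (equivariant_dn (equivariant_dn hE))) h.
  rewrite -(good_vd hT); last exact: vd_shift_smooth.
  congr vd; apply: stateP => -[|i]; rewrite !packE; first by rewrite (good_zero _ hT).
  by rewrite (good_eqv hT) //; move/smooth_at: h => /(_ i)/smooth_dn/smooth_dn.
Qed.

Fixpoint lift w (T : operator) : operator :=
  match w with
  | [::] => T
  | Up :: w' => fun tau phi => pack (fun i => lift w' T (tau - 1) phi.@i)
  | Dn :: w' => fun tau => lift w' T (tau + 1)
  end.

Lemma good_lift w p q T : good p q T -> good (w ++ p) (w ++ q) (lift w T).
Proof. by elim: w => //= -[] w IH /IH; [exact: good_up | exact: good_dn]. Qed.

Lemma lift_cat w w' T : lift (w ++ w') T = lift w (lift w' T).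
Proof. by elim: w => //= -[] w ->. Qed.

Lemma lift_comp w T U :
  lift w (fun tau phi => T tau (U tau phi)) =
  fun tau phi => lift w T tau (lift w U tau phi).
Proof. by elim: w => //= -[] w ->. Qed.

Lemma lift_id w : lift w (fun _ phi => phi) = fun _ phi => phi.
Proof.
elim: w => //= -[] w -> //.
by apply: funext => tau; apply: funext => phi; rewrite comp_atK.
Qed.

Lemma lift_vlin w a T U :
  lift w (fun tau phi => vlin a (T tau phi) (U tau phi)) =
  fun tau phi => vlin a (lift w T tau phi) (lift w U tau phi).
Proof. by elim: w => //= -[] w ->. Qed.

Lemma lift_null w : lift w (fun _ _ => vzero R) = fun _ _ => vzero R.
Proof. by elim: w => //= -[] w ->. Qed.

Lemma lift_eq w p T U :
  (forall tau phi, smooth p phi -> T tau phi = U tau phi) ->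
  forall tau phi, smooth (w ++ p) phi -> lift w T tau phi = lift w U tau phi.
Proof.
move=> h; elim: w => //= -[] w IH tau phi hs; last by rewrite IH //; exact/smooth_dn.
by congr pack; apply: funext => i; rewrite IH //; exact: smooth_at.
Qed.

Definition monomial (T : state -> state) := exists (e : stream -> R) (s : stream -> stream),
  forall phi x, T phi x = e x * phi (s x).

(** At each point such an operator is a scalar times an evaluation, and a scalar can be taken out of
    the integral. *)
Lemma good_monomial p q (T : state -> state) :
  monomial T -> equivariant p q T -> good p q (fun _ => T).
Proof.
move=> [e [s hT]] hE; split=> [_ a phi psi _ _|_ //|tau phi h].
  by apply: funext => x; rewrite hT /vlin !hT; ring.
apply: funext => x; rewrite hT.
have hc : evconst (fun i => gami p i phi.@i (s x)) by exact: vd_evconst.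
have h0 : evconst (fun _ : nat => 0 : R) by exists 0%N.
transitivity (integ tau (fun i => e x * gami p i phi.@i (s x) + 0)).
  congr integ; apply: funext => i; rewrite packE (equivariant_gami _ hE) ?hT ?addr0 //.
  by apply/smooth_dn; exact: smooth_at.
by rewrite integ_lin // integ_cst mulr0 addr0.
Qed.

Lemma good_vX p : good [:: Up, Up & p] [:: Up, Up & p] (fun _ => @vX R).
Proof.
apply: good_monomial => [|k phi _]; last exact: vX_sw.
exists (fun=> 1), (fun x => scons (bump (x 0%N) (x 1%N))
  (scons (unbump (bump (x 0%N) (x 1%N)) (x 0%N)) (stl (stl x)))).
by move=> phi x; rewrite mul1r.
Qed.

Lemma good_vc p : good p [:: Dn, Up & p] (fun _ => @vc R).
Proof.
apply: good_monomial => [|k phi _].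
  exists (fun x => (x 0%N == 0%N)%:R), stl => phi x; rewrite /vc /pack.
  by case: (x 0%N) => [|n] /=; rewrite ?mul1r ?mul0r.
apply: stateP => i; rewrite /vc packE sw_dn.
case: (sw_upP k.+1 _ (pack _) i) => [hi|->|->|hi]; rewrite packE //.
- by case: i hi => [|i] hi.
- by case: i hi => [|i] hi.
Qed.

Lemma good_vd' p : good [:: Dn, Up & p] p (fun _ phi => phi.@0).
Proof.
apply: good_monomial => [|k phi _]; last by rewrite sw_dn sw_upl.
by exists (fun=> 1), (scons 0) => phi x; rewrite mul1r.
Qed.

Lemma good_vc' p : good p [:: Up, Dn & p] (fun _ => @vc' R p).
Proof.
apply: good_monomial => [|k phi _].
  have gam_pre i : exists s : stream -> stream, forall phi : state, gam p i phi = phi \o s.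
    elim: i => [|i [s IH]]; first by exists id.
    by exists (sigma i p \o s) => phi /=; rewrite IH.
  have [s hs] := choice gam_pre.
  by exists (fun=> 1), (fun x => s (x 0%N) (stl x)) => phi x; rewrite mul1r /vc' /pack hs.
apply: stateP => i; apply: (can_inj (gamiK p i)).
by rewrite gami_sw /vc' !packE !gamK.
Qed.

Lemma gami2_sw r k phi i j :
  gami r j (gami [:: Up, Dn & r] i (sw k [:: Up, Dn, Up, Dn & r] phi).@i).@j =
  sw k r (gami r (adj k j)
    (gami [:: Up, Dn & r] (adj k i) phi.@(adj k i)).@(adj k j)).
Proof. by rewrite gami_sw gami_sw. Qed.

(** Naturality of [vd] at itself is the exchange of two integrals. *)
Lemma good_vd_vd p : good [:: Up, Dn & p] p (vd p).
Proof.
split=> [tau a phi psi|tau|tau phi h]; [exact: vd_lin | exact: vd_equivariant|].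
apply: funext => x.
transitivity (integ tau (fun i => integ tau (fun j =>
    gami p j (gami [:: Up, Dn & p] i phi.@i).@j x))).
  congr integ; apply: funext => i.
  rewrite packE (equivariant_gami _ (@vd_equivariant p tau)) //.
  exact/smooth_dn/smooth_at.
have [K hK] := h; have [B hB] := sigma_far p x.
(* Beyond K the transpositions fix [phi], and beyond B they fix the point x, so only the two
   variables are moved. *)
rewrite (@integ_fubini _ _ _ (K + B)) => [|k i j hk]; last first.
  by rewrite -[in RHS](hK k) ?gami2_sw /sw ?hB //; lia.
congr integ; apply: funext => j.
by have [s hs] := gami_pre R p j; rewrite !hs; congr integ; apply: funext => i; rewrite hs.
Qed.

End Operators.

(** * The representation of the Heisenberg category *)

Section Interpretation.
Variable R : comPzRingType.
Local Notation state := (state R).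
Local Notation operator := (operator R).
Implicit Types (phi psi : state) (p q r : seq arrow) (tau : R).

(* [r] is the word to the right of [f] and [tau] the size of the current set to
   the left of [f]. *)
Fixpoint interp a b (f : term R a b) r : operator :=
  match f with
  | tzero _ _ => fun _ _ => vzero R
  | tadd _ _ f g => fun tau phi => vlin 1 (interp f r tau phi) (interp g r tau phi)
  | topp _ _ f => fun tau phi => vlin (-1) (interp f r tau phi) (vzero R)
  | tscale _ _ c f => fun tau phi => vlin c (interp f r tau phi) (vzero R)
  | tid _ => fun _ phi => phi
  | tcomp _ _ _ f g => fun tau phi => interp f r tau (interp g r tau phi)
  | ttens a _ _ b' f g => fun tau phi =>
      interp f (b' ++ r) tau (lift a (interp g r) tau phi)
  | gX => fun _ => @vX R
  | gc => fun _ => @vc R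
  | gd => vd r
  | gc' => fun _ => @vc' R r
  | gd' => fun _ phi => phi.@0
  end.

Lemma interp_good a b (f : term R a b) r : good (a ++ r) (b ++ r) (interp f r).
Proof.
elim: a b / f r => /=.
- by move=> *; exact: good_null.
- by move=> a b f IHf g IHg r; exact: good_vlin.
- by move=> a b f IHf r; apply: good_vlin => //; exact: good_null.
- by move=> a b c f IHf r; apply: good_vlin => //; exact: good_null.
- by move=> a r; exact: good_id.
- by move=> a b c f IHf g IHg r; exact: good_comp (IHf r) (IHg r).
- move=> a b a' b' f IHf g IHg r; rewrite -!catA.
  exact: good_comp (IHf _) (good_lift a (IHg r)).
- exact: good_vX.
- exact: good_vc.
- exact: good_vd_vd.
- exact: good_vc'.
- exact: good_vd'.
Qed.

(** The interchange law, with [T] standing for the factor on the right. Source and target of each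
    generator change the size by the same amount, so [T] is used at the same size on both sides. *)
Lemma interp_natural a b (f : term R a b) p q T : good p q T ->
  forall tau phi, smooth (a ++ p) phi ->
  interp f q tau (lift a T tau phi) = lift b T tau (interp f p tau phi).
Proof.
elim: a b / f p q T => /=.
- by move=> a b p q T hT tau phi _; rewrite (good_zero _ (good_lift b hT)).
- move=> a b f IHf g IHg p q T hT tau phi h.
  rewrite (good_lin (good_lift b hT)) ?(IHf p) ?(IHg p) //.
    exact: good_smooth (interp_good f p) h.
  exact: good_smooth (interp_good g p) h.
- move=> a b f IHf p q T hT tau phi h.
  rewrite (good_lin (good_lift b hT)) ?(IHf p) ?(good_zero _ (good_lift b hT)) //.
    exact: good_smooth (interp_good f p) h.
  exact: smooth_zero.
- move=> a b c f IHf p q T hT tau phi h.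
  rewrite (good_lin (good_lift b hT)) ?(IHf p) ?(good_zero _ (good_lift b hT)) //.
    exact: good_smooth (interp_good f p) h.
  exact: smooth_zero.
- by [].
- move=> a b c f IHf g IHg p q T hT tau phi h.
  rewrite (IHg p) // (IHf p) //; exact: good_smooth (interp_good g p) h.
- move=> a b a' b' f IHf g IHg p q T hT tau phi; rewrite -catA => h.
  rewrite !lift_cat -(IHf (b' ++ p) (b' ++ q)) //; last 2 first.
  + exact: good_lift.
  + exact: good_smooth (good_lift a (interp_good g p)) h.
  congr (interp f _ _ _).
  have := @lift_eq R a (a' ++ p) (fun tau phi => interp g q tau (lift a' T tau phi))
    (fun tau phi => lift b' T tau (interp g p tau phi)) _ tau phi h.
  rewrite (lift_comp a (interp g q)) (lift_comp a (lift b' T)).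
  by apply => tau' phi' h'; exact: IHg.
- by [].
- move=> p q T hT tau phi _; apply: stateP => -[|i]; rewrite /vc !packE addrK //.
  by rewrite (good_zero _ hT).
- move=> p q T hT tau phi h; rewrite subrK; exact: good_vd.
- move=> p q T hT tau phi h; apply: stateP => i; rewrite /vc' !packE subrK.
  apply: (can_inj (gamiK q i)).
  rewrite gamK (equivariant_gami _ (good_eqv hT tau)) ?gamK //.
  by elim: i phi h => //= i IH phi h; apply: IH; exact: smooth_sw.
- by move=> p q T hT tau phi _; rewrite addrK packE.
Qed.

Lemma interp_tcast a b a' b' (ea : a = a') (eb : b = b') (f : term R a b) :
  interp (tcast ea eb f) = interp f.
Proof. by case: _ / ea; case: _ / eb. Qed.

(** On states that are not smooth [integ] may return its default value 0, and linearity and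
    naturality of [vd] may fail. *)
Definition sem_eq a b (f g : term R a b) := forall r tau phi,
  smooth (a ++ r) phi -> interp f r tau phi = interp g r tau phi.

Lemma interp_smooth a b (f : term R a b) r tau phi :
  smooth (a ++ r) phi -> smooth (b ++ r) (interp f r tau phi).
Proof. exact/good_smooth/interp_good. Qed.

Lemma interp_lin a b (f : term R a b) r tau c phi psi :
  smooth (a ++ r) phi -> smooth (a ++ r) psi ->
  interp f r tau (vlin c phi psi) =
  vlin c (interp f r tau phi) (interp f r tau psi).
Proof. by move=> h1 h2; rewrite (good_lin (interp_good f r)). Qed.

Lemma interp_zero a b (f : term R a b) r tau :
  interp f r tau (vzero R) = vzero R.
Proof. exact: good_zero (interp_good f r). Qed.

Definition vpoint (k : nat) psi : state :=
  pack (fun i => if i == k then psi else vzero R).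

Lemma gami_vc r i psi : gami (Up :: r) i (vc psi) = vpoint i psi.
Proof.
elim: i => [|i /= ->]; apply: stateP => j; rewrite /vc /vpoint packE //.
  by case: j.
case: (sw_upP i _ (pack _) j) => [h|->|->|h]; rewrite ?packE.
- by rewrite !ifN ?sw_vzero //; lia.
- by rewrite !ifN //; lia.
- by rewrite !eqxx.
- by rewrite !ifN ?sw_vzero //; lia.
Qed.

(** Over the word Dn Up the choice is either the new element 0 or an old one. The morphism l forgets
    the first case and r extends by zero to it, which gives both relations between them. *)
Lemma interp_ml r tau phi :
  interp (ml R) r tau phi = pack (fun i => phi.@(i.+1)).
Proof.
by apply: stateP => i; rewrite /ml /= /vX /vc' !packE /bump /unbump /=.
Qed.

Lemma vd_point r tau k psi : vd r tau (vpoint k psi) = gami r k psi.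
Proof.
apply: funext => x; rewrite /vd (@integ_point _ _ k) => [|i hi].
  by rewrite /vpoint packE eqxx.
rewrite /vpoint packE (negbTE hi).
by have [s ->] := gami_pre R r i.
Qed.

Lemma interp_mr r tau phi :
  interp (mr R) r tau phi =
  pack (fun i => if i is j.+1 then phi.@j else vzero R).
Proof.
apply: stateP => i; rewrite /mr /= !packE.
rewrite -[RHS](vd_point r (tau + 1 - 1) 0); congr vd.
apply: stateP => j; rewrite /vpoint /vc !packE.
case: i => [|i]; first by rewrite /bump /= if_same.
by case: j => [|j]; rewrite /bump /unbump /= ?subn1 //; case: leqP.
Qed.

Lemma interp_mY r tau phi : interp (mY R) r tau phi = sw 0 r phi.
Proof. by []. Qed.

Lemma vXK : involutive (@vX R).
Proof.
move=> phi; apply: stateP => i; apply: stateP => j; rewrite /vX !packE.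
by congr (_.@_.@_); rewrite /bump /unbump; lia.
Qed.

Lemma vX_braid phi :
  vX (pack (fun i => vX (vX phi).@i)) =
  pack (fun i => vX (vX (pack (fun i => vX phi.@i))).@i).
Proof.
apply: stateP => i; apply: stateP => j; apply: stateP => k.
rewrite /vX !packE.
(* [is_var] makes the innermost terms go first; each is named after its case is decided, and
   impossible orders are discarded at once. *)
repeat match goal with
| |- context [bump ?x ?y] => is_var x; is_var y;
    let a := fresh "a" in let e := fresh "e" in
    remember (bump x y) as a eqn:e; rewrite /bump in e;
    case: (leqP x y) e => ? /= e; try (exfalso; lia)
| |- context [unbump ?x ?y] => is_var x; is_var y;
    let a := fresh "a" in let e := fresh "e" in
    remember (unbump x y) as a eqn:e; rewrite /unbump in e;
    case: (ltnP x y) e => ? /= e; try (exfalso; lia)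
end.
all: by congr (_.@_.@_.@_); lia.
Qed.

Lemma heq_sound a b (f g : term R a b) : heq f g -> sem_eq f g.
Proof.
move=> h; elim: a b f g / h; rewrite /sem_eq;
  (* The two relations between l and r stay unsimplified, so that [interp_ml] and [interp_mr] apply
     to them. *)
  lazymatch goal with |- context [ml] => idtac | _ => move=> /= end.
- by [].
- by move=> a b f g _ IH r tau phi h; rewrite IH.
- by move=> a b f g k _ IH _ IH' r tau phi h; rewrite IH ?IH'.
- by move=> a b f f' g g' _ IH _ IH' r tau phi h; rewrite IH ?IH'.
- by move=> a b f f' _ IH r tau phi h; rewrite IH.
- by move=> a b c f f' _ IH r tau phi h; rewrite IH.
- move=> a b c f f' g g' _ IH _ IH' r tau phi h.
  by rewrite IH' // IH //; exact: interp_smooth.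
- move=> a b a' b' f f' g g' _ IH _ IH' r tau phi; rewrite -catA => h.
  rewrite (lift_eq (IH' r)) // IH //.
  exact: good_smooth (good_lift a (interp_good g' r)) h.
- by move=> *; apply: funext => x; rewrite /vlin; ring.
- by move=> *; apply: funext => x; rewrite /vlin; ring.
- by move=> *; apply: funext => x; rewrite /vlin /vzero; ring.
- by move=> *; apply: funext => x; rewrite /vlin /vzero; ring.
- by move=> *; apply: funext => x; rewrite /vlin /vzero; ring.
- by move=> *; apply: funext => x; rewrite /vlin /vzero; ring.
- by move=> *; apply: funext => x; rewrite /vlin /vzero; ring.
- by move=> *; apply: funext => x; rewrite /vlin /vzero; ring.
- by [].
- move=> a b c f g g' r tau phi h.
  by rewrite interp_lin //; exact: interp_smooth.
- by [].
- move=> a b c s f g r tau phi h.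
  rewrite interp_lin ?interp_zero //; [exact: interp_smooth | exact: smooth_zero].
- by [].
- move=> a b a' b' f g g' r tau phi; rewrite -catA => h.
  rewrite lift_vlin interp_lin //.
    exact: good_smooth (good_lift a (interp_good g r)) h.
  exact: good_smooth (good_lift a (interp_good g' r)) h.
- by [].
- move=> a b a' b' s f g r tau phi; rewrite -catA => h.
  rewrite (lift_vlin _ _ _ (fun _ _ => vzero R)) interp_lin ?lift_null ?interp_zero //.
    exact: good_smooth (good_lift a (interp_good g r)) h.
  exact: smooth_zero.
- by [].
- by [].
- by [].
- by move=> a b r tau phi _; rewrite lift_id.
- move=> a b c a' b' c' f g f' g' r tau phi; rewrite -catA => h.
  rewrite (lift_comp a (interp f' r)) (interp_natural _ (interp_good f' r)) //.
  exact: good_smooth (good_lift a (interp_good g' r)) h.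
- move=> a b a' b' a'' b'' f g k r tau phi h; rewrite interp_tcast /=.
  by rewrite lift_cat (lift_comp a (interp g _)) catA.
- by [].
- by move=> a b f r tau phi h; rewrite interp_tcast /= lift_id.
- by move=> r tau phi _; exact: vXK.
- by move=> r tau phi _; exact: vX_braid.
(* The cycle moves the point mass of the cup from 0 to i, so only the i equal to the element chosen
   by x contributes to the integral. *)
- move=> r tau phi _; apply: funext => x; rewrite comp_atK /vd.
  rewrite (@integ_point _ _ (x 0%N)) => [|i hi].
    by rewrite packE gami_vc /vpoint pack_app eqxx comp_at_app scons_eta.
  by rewrite packE gami_vc /vpoint pack_app eq_sym (negbTE hi).
- move=> r tau phi _; rewrite -[RHS](vd_point r (tau + 1) 0); congr vd.
  by apply: stateP => -[|i]; rewrite /vc /vpoint !packE.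
- move=> r tau phi _.
  rewrite -[LHS]/(interp (ml R) r tau (interp (mr R) r tau phi)) interp_mr interp_ml.
  by apply: stateP => i; rewrite !packE.
- move=> r tau phi _.
  rewrite -[LHS]/(interp (mr R) r tau (interp (ml R) r tau phi)) interp_ml interp_mr /=.
  apply: stateP => i; rewrite !packE /vc !vlin_at; case: i => [|i]; rewrite !packE vzero_at;
    by apply: funext => x; rewrite /vlin /vzero; ring.
- move=> r tau phi _; rewrite packE; apply: stateP => j; rewrite /vX /vc !packE.
  by rewrite /bump.
- by [].
Qed.

End Interpretation.

(** * Named coordinates and the images of the generators *)

Section Named.
Variables (R : comPzRingType) (t : R).
Local Notation state := (state R).
Local Notation operator := (operator R).
Implicit Types (phi psi chi : state) (p r : seq arrow).

Lemma lift_ud m (T : operator) tau phi :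
  lift (ud m.+1) T tau phi = pack (fun i => lift (ud m) T tau phi.@i).
Proof. by rewrite /= subrK. Qed.

(** Only size t is considered, as the bubble acts by the current size. By [lift_ud] the strands
    [ud n] on the left leave this size unchanged, so the relation survives tensor products inside
    H_ud. *)
Lemma hteq_sound m l (f g : term R (ud m) (ud l)) : hteq t f g ->
  forall r phi, smooth (ud m ++ r) phi -> interp f r t phi = interp g r t phi.
Proof.
move=> h; elim: m l f g / h.
- by move=> m l f g /heq_sound h r phi; exact: h.
- move=> r phi _ /=; apply: funext => x; rewrite /vd /vlin /vzero addr0.
  rewrite -integ_cst; congr integ; apply: funext => i.
  by rewrite /vc' packE gamK.
- by move=> m l f g _ IH r phi h; rewrite IH.
- by move=> m l f g k _ IH _ IH' r phi h; rewrite IH ?IH'.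
- by move=> m l f f' g g' _ IH _ IH' r phi h /=; rewrite IH ?IH'.
- by move=> m l f f' _ IH r phi h /=; rewrite IH.
- by move=> m l c f f' _ IH r phi h /=; rewrite IH.
- move=> m l k f f' g g' _ IH _ IH' r phi h /=.
  by rewrite IH' // IH //; exact: interp_smooth.
- move=> m l m' l' f f' g g' _ IH _ IH' r phi.
  rewrite /ud_tens !interp_tcast -udD -catA => h.
  (* [lift_eq] asks for agreement at all sizes, while the induction hypothesis gives it at t
     only. *)
  have lift_eq_t n psi : smooth (ud n ++ (ud m' ++ r)) psi ->
      lift (ud n) (interp g r) t psi = lift (ud n) (interp g' r) t psi.
    elim: n psi => [|n IHn] psi hs; first exact: IH'.
    rewrite !lift_ud; congr pack; apply: funext => i; apply: IHn.
    by apply/smooth_dn; exact: smooth_at.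
  rewrite /= lift_eq_t // IH //.
  exact: good_smooth (good_lift _ (interp_good g' r)) h.
Qed.

(* Named coordinates on [(Up Dn)^n]: the elements chosen by the strands [Up] are
   all viewed in the ambient set, every strand [Dn] replacing the element
   removed just before it. *)
Fixpoint named n phi : state :=
  if n is n'.+1 then pack (fun y => named n' (gami (ud n') y phi.@y)) else phi.

Lemma named_pre n : exists s : stream -> stream, forall phi, named n phi = phi \o s.
Proof.
elim: n => [|n [s IH]]; first by exists id.
have [g hg] := choice (gami_pre R (ud n)).
exists (fun x => scons (x 0%N) (g (x 0%N) (s (stl x)))) => phi /=.
by apply: funext => x; rewrite pack_app IH hg /= comp_at_app.
Qed.

Fixpoint unnamed n chi : state :=
  if n is n'.+1 then pack (fun y => gam (ud n') y (unnamed n' chi.@y)) else chi.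

Lemma unnamedK n : cancel (unnamed n) (named n).
Proof.
by elim: n => [|n IH] chi //; apply: stateP => y; rewrite /= !packE gamK IH.
Qed.

Fixpoint delta n (x : stream) : state :=
  if n is n'.+1 then vpoint (x 0%N) (delta n' (stl x)) else fun=> 1.

Lemma delta_smooth n x : smooth (ud n) (unnamed n (delta n x)).
Proof.
suff [K hK] : exists K, forall k, (K <= k)%N ->
    sw k (ud n) (unnamed n (delta n x)) = unnamed n (delta n x) by exists K.
elim: n x => [|n IH] x; first by exists 0%N.
have [K hK] := IH (stl x); exists (K + (x 0).+1)%N => k hk.
apply: stateP => y; rewrite [ud _.+1]/=; apply: (can_inj (gamiK (ud n) y)).
rewrite gami_sw [unnamed _.+1 _]/= /vpoint !packE !gamK.
have -> : (adj k y == x 0%N) = (y == x 0%N).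
  by rewrite /adj; repeat case: ifP => /eqP; lia.
have z : unnamed n (vzero R) = vzero R.
  elim: (n) => //= j IHj; apply: stateP => i; rewrite packE vzero_at IHj.
  by elim: i => //= i IHi; rewrite sw_vzero.
by case: eqP => _; rewrite ?z ?sw_vzero // hK //; lia.
Qed.

(** The q pairs to the right are arbitrary, because in a tensor product the left factor acts with
    the pairs of the right factor behind it. *)
Definition acts m l (f : term R (ud m) (ud l)) (W : state -> state) :=
  forall q phi, smooth (ud (m + q)) phi ->
  named (l + q) (interp f (ud q) t phi) = W (named (m + q) phi).

Lemma interp_ud_smooth m l (f : term R (ud m) (ud l)) q phi :
  smooth (ud (m + q)) phi -> smooth (ud (l + q)) (interp f (ud q) t phi).
Proof. by rewrite -!udD => h; exact: interp_smooth. Qed.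

Lemma acts_hteq m l (f g : term R (ud m) (ud l)) W :
  hteq t f g -> acts f W -> acts g W.
Proof. by move=> h hf q phi hs; rewrite -hf // (hteq_sound h) // udD. Qed.

Lemma acts_comp m l k (f : term R (ud l) (ud k)) (g : term R (ud m) (ud l)) W V :
  acts f W -> acts g V -> acts (tcomp f g) (W \o V).
Proof.
move=> hf hg q phi hs; rewrite /= hf ?hg //; exact: interp_ud_smooth.
Qed.

Fixpoint under n (W : state -> state) chi : state :=
  if n is n'.+1 then pack (fun i => under n' W chi.@i) else W chi.

Lemma named_lift n a b (T : operator) (W : state -> state) phi :
  good (ud a) (ud b) T ->
  (forall psi, smooth (ud a) psi -> named b (T t psi) = W (named a psi)) ->
  smooth (ud (n + a)) phi ->
  named (n + b) (lift (ud n) T t phi) = under n W (named (n + a) phi).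
Proof.
move=> hT hW; elim: n phi => [|n IH] phi h; first exact: hW.
rewrite lift_ud addSn /=; apply: stateP => y; rewrite !packE.
have hs : smooth (ud (n + a)) phi.@y by apply/smooth_dn; exact: smooth_at h.
rewrite -IH; last exact: smooth_gami.
have := good_eqv (good_lift (ud n) hT) t; rewrite !udD => hE.
by rewrite (equivariant_gami _ hE).
Qed.

Lemma acts_tens m l m' l' (f : term R (ud m) (ud l)) (g : term R (ud m') (ud l')) W V :
  acts f W -> acts g V -> acts (ud_tens f g) (W \o under m V).
Proof.
move=> hf hg q phi hs; rewrite /ud_tens interp_tcast /= udD -!addnA.
rewrite -addnA in hs.
have hG := interp_good g (ud q); rewrite !udD in hG.
rewrite hf; last first.
  by have := good_lift (ud m) hG; rewrite !udD => /good_smooth; apply.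
by rewrite (named_lift hG (hg q)).
Qed.

Definition named2 p phi a b :=
  gami p b (gami [:: Up, Dn & p] a phi.@a).@b.

Lemma named_at2 q phi a b :
  (named q.+2 phi).@a.@b = named q (named2 (ud q) phi a b).
Proof. by rewrite /= !packE. Qed.

Lemma named2E p phi a b : named2 p phi a b =
  gami p b (if a == b then phi.@a.@0
            else gami (Dn :: p) (unbump b a) phi.@a.@(unbump a b).+1).
Proof. by rewrite /named2 gami_up. Qed.

Lemma gami_gami_lt p a b chi : (a < b)%N ->
  gami p b (gami p a.+1 chi) = gami p a (gami (Dn :: p) b.-1 chi).
Proof.
case: b => // b; elim: a => [|a IH] h; first by rewrite -gami_dn /= swK.
by rewrite [gami p a.+2 _]/= sw_gami_gt // IH 1?ltnW.
Qed.

(** Replacing a and then b by new elements, or b and then a, gives the same set up to the exchange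
    of the two new elements. *)
Lemma gami_gami p a b chi : a != b ->
  gami p b (gami (Dn :: p) (unbump b a) (sw 0 p chi)) =
  gami p a (gami (Dn :: p) (unbump a b) chi).
Proof.
move=> hab; case: (ltngtP a b) hab => // h _.
  rewrite gami_dn; have -> : unbump b a = a by rewrite /unbump; lia.
  by rewrite gami_gami_lt //; congr (gami _ _ (gami _ _ _)); rewrite /unbump; lia.
have -> : unbump a b = b by rewrite /unbump; lia.
have -> : unbump b a = a.-1 by rewrite /unbump; lia.
by rewrite -gami_gami_lt // -gami_dn swK.
Qed.

(** In named coordinates the generators become the structure maps of the Frobenius algebra of
    functions on a set of measure t. *)
Lemma acts_mu : acts (Psi_mu R) (fun chi => pack (fun a => chi.@a.@a)).
Proof.
move=> q phi _; apply: stateP => a.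
by rewrite packE named_at2 named2E eqxx /= !packE.
Qed.

Lemma acts_delta : acts (Psi_delta R)
  (fun chi => pack (fun a => pack (fun b => if a == b then chi.@a else vzero R))).
Proof.
move=> q phi _; apply: stateP => a; apply: stateP => b.
rewrite named_at2 named2E !packE.
case: eqP => [->|_] //=.
have [s1 h1] := gami_pre R (Dn :: ud q) (unbump b a).
have [s2 h2] := gami_pre R (ud q) b.
have [s3 h3] := named_pre q.
by rewrite h1 h2 h3.
Qed.

Lemma acts_eta : acts (Psi_eta R) (fun chi => pack (fun=> chi)).
Proof. by move=> q phi _; apply: stateP => a; rewrite /= /vc' !packE gamK. Qed.

Lemma acts_eps : acts (Psi_eps R) (fun chi x => integ t (fun i => chi.@i x)).
Proof.
move=> q phi _; apply: funext => x /=.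
have [s hs] := named_pre q.
rewrite hs /= /vd; congr integ; apply: funext => i.
by rewrite packE hs.
Qed.

Lemma acts_s : acts (Psi_s R) (fun chi => pack (fun a => pack (fun b => chi.@b.@a))).
Proof.
move=> q phi _; apply: stateP => a; apply: stateP => b.
rewrite [LHS]named_at2 [in RHS]packE [in RHS]packE [RHS]named_at2; congr named.
(* The summand with [X] and [Y] lives on pairs of distinct elements, since l and r kill the choice
   of the element just put back; the summand c d' supplies the coinciding pairs. *)
pose psi := pack (fun i => pack (fun j => if j is j'.+1 then
   sw 0 (ud q) phi.@(bump i j').@(unbump (bump i j') i).+1 else phi.@i.@0)).
have -> : interp (Psi_s R) (ud q) t phi = psi.
  have eml r : interp (ml R) r = fun tau phi => pack (fun i => phi.@(i.+1)).
    by apply: funext => tau; apply: funext => chi; rewrite interp_ml.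
  have emr r : interp (mr R) r =
      fun tau phi => pack (fun i => if i is j.+1 then phi.@j else vzero R).
    by apply: funext => tau; apply: funext => chi; rewrite interp_mr.
  have emY r : interp (mY R) r = fun tau phi => sw 0 r phi.
    by apply: funext => tau; apply: funext => chi; rewrite interp_mY.
  rewrite /Psi_s; cbn [interp lift cat]; rewrite eml emr emY.
  apply: stateP => i; apply: stateP => j; rewrite vlin_at vlin_at /psi !packE.
  case: j => [|j]; rewrite ?packE; apply: funext => x;
    by rewrite /vlin /vzero mul1r ?addr0 ?add0r.
rewrite !named2E /psi !packE eq_sym.
case: eqP => [->|/eqP hab] //.
have -> : bump a (unbump a b) = b by rewrite /bump /unbump; lia.
by apply: gami_gami; rewrite eq_sym.
Qed.

End Named.

(** * Composition of labelled diagrams *)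

Lemma diagramP m l (D E : diagram m l) :
  (forall x y, same_block D x y = same_block E x y) -> D = E.
Proof.
move=> h; apply: val_inj.
rewrite -(equivalence_partition_pblock (valP D)) -(equivalence_partition_pblock (valP E)).
rewrite /equivalence_partition; apply: eq_imset => x; apply/setP => y.
by rewrite !inE; exact: h.
Qed.

Section Stars.
Variables (m l k : nat) (D : diagram l k) (D' : diagram m l).

Lemma connect_lower x y : same_block D' x y ->
  connect (stack_adj D D') (lower k x) (lower k y).
Proof.
move=> h; apply: connect1; apply/orP; left.
by apply/existsP; exists x; apply/existsP; exists y; rewrite h !eqxx.
Qed.

Lemma connect_upper x y : same_block D x y ->
  connect (stack_adj D D') (upper m x) (upper m y).
Proof.
move=> h; apply: connect1; apply/orP; right.
by apply/existsP; exists x; apply/existsP; exists y; rewrite h !eqxx.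
Qed.

(** By the first two hypotheses the labels are constant on connected components of the stack; by the
    third they separate components at the outer vertices. *)
Lemma star_labels (U : eqType) (F : stacked m l k -> U) (E : diagram m k) :
  (forall x y, same_block D' x y -> F (lower k x) = F (lower k y)) ->
  (forall x y, same_block D x y -> F (upper m x) = F (upper m y)) ->
  (forall x y, F (outer l x) = F (outer l y) ->
     connect (stack_adj D D') (outer l x) (outer l y)) ->
  (forall x y, same_block E x y = (F (outer l x) == F (outer l y))) ->
  star D D' = E.
Proof.
move=> hD' hD hF hE; apply: diagramP => x y; rewrite diagram_ofE hE.
apply/idP/eqP; last exact: hF.
move/connectP => [p]; elim: p (outer l x) => [|v p IH] u /=; first by move=> _ ->.
case/andP => + hp e; rewrite -(IH _ hp e) => /orP[] /existsP[a /existsP[b]].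
  by case/and3P => h /eqP -> /eqP ->; exact: hD'.
by case/and3P => h /eqP -> /eqP ->; exact: hD.
Qed.

Lemma loops_outer :
  (forall j : 'I_l, exists x,
     connect (stack_adj D D') (inl (inr j)) (outer l x)) -> loops D D' = 0%N.
Proof.
move=> h; apply/eqP; rewrite cards_eq0; apply/eqP/setP => C; rewrite !inE.
apply/negP => /andP[/imsetP[u _ ->] /subsetP sub].
have hu : u \in middle m l k by apply: sub; rewrite inE in_setT connect0.
case/imsetP: hu => j _ eu; case: (h j) => x hx.
have : outer l x \in middle m l k by apply: sub; rewrite inE in_setT eu hx.
by case/imsetP => j' _; case: x {hx}.
Qed.

End Stars.

(* [h true] labels the top vertices and [h false] the bottom ones. *)
Definition label m l (h : bool -> nat -> nat) (x : vertex m l) : nat :=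
  match x with inl i => h false i | inr i => h true i end.

Definition labelled m l h : diagram m l := diagram_of (fibers_equiv (@label m l h)).

Lemma labelledE m l h x y :
  same_block (labelled m l h) x y = (label h x == label h y).
Proof. exact: diagram_ofE. Qed.

Lemma idp_labelled n : idp n = labelled n n (fun _ i => i).
Proof. by apply: diagramP => x y; rewrite labelledE diagram_ofE; case: x; case: y. Qed.

Lemma one_block_labelled m l : one_block m l = labelled m l (fun _ _ => 0%N).
Proof. by apply: diagramP => x y; rewrite labelledE diagram_ofE; case: x; case: y. Qed.

Lemma swap_labelled : swap = labelled 2 2 (fun s i => if s then adj 0 i else i).
Proof.
by apply: diagramP => x y; rewrite labelledE diagram_ofE;
  case: x => -[[|[|i]] hi] //; case: y => -[[|[|j]] hj].
Qed.

Lemma labelled_eq m l h h' :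
  (forall s i s' i', (i < if s then l else m)%N -> (i' < if s' then l else m)%N ->
     (h s i == h s' i') = (h' s i == h' s' i')) ->
  labelled m l h = labelled m l h'.
Proof.
move=> e; apply: diagramP => x y; rewrite !labelledE.
by case: x => x; case: y => y; apply: e => /=.
Qed.

(** The offset N keeps the labels of the two factors apart, and the right factor comes first in the
    numbering. *)
Lemma juxt_labelled m l m' l' h h' N :
  (forall s i, (i < if s then l' else m')%N -> (h' s i < N)%N) ->
  juxt (labelled m l h) (labelled m' l' h') =
  labelled (m + m') (l + l') (fun s i =>
    let c := if s then l' else m' in
    if (i < c)%N then h' s i else (N + h s (i - c))%N).
Proof.
move=> hN; apply: diagramP => x y; rewrite labelledE diagram_ofE /juxt_rel.
pose H s i := let c := if s then l' else m' in
    if (i < c)%N then h' s i else (N + h s (i - c))%N.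
have side (z : vertex (m + m') (l + l')) : label H z =
    match juxt_side z with inl u => (N + label h u)%N | inr v => label h' v end.
  by case: z => i; rewrite /= /H;
    [case: (splitP (cast_ord (addnC m m') i)) | case: (splitP (cast_ord (addnC l l') i))]
    => j /= ->; rewrite ?ltn_ord ?addKn // ltnNge leq_addr.
have lt (v : vertex m' l') : (label h' v < N)%N.
  by case: v => i; [apply: (hN false) | apply: (hN true)] => /=.
rewrite -/H !side; case: (juxt_side x) => u; case: (juxt_side y) => v.
- by rewrite labelledE eqn_add2l.
- by apply/esym/negbTE; rewrite neq_ltn orbC ltn_addr // lt.
- by apply/esym/negbTE; rewrite neq_ltn ltn_addr // lt.
- by rewrite labelledE.
Qed.

(** Each vertex is joined to the one above it, so these diagrams are equivalence relations on n
    parallel strands, and composing them is taking the join. *)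
Definition column n (f : nat -> nat) : diagram n n := labelled n n (fun _ i => f i).

Definition join (i j x : nat) : nat := if x == j then i else x.
Definition merge (i j : nat) (f : nat -> nat) (x : nat) : nat :=
  if f x == f j then f i else f x.

Definition stack_idx m l k (u : stacked m l k) : nat :=
  match u with inl (inl i) => i | inl (inr i) => i | inr i => i end.

Section ColumnStars.
Variable n : nat.

Lemma star_join i j f : (i < n)%N -> (j < n)%N ->
  star (column n (join i j)) (column n f) = column n (merge i j f).
Proof.
move=> hi hj; pose F (u : stacked n n n) := merge i j f (stack_idx u).
set A := stack_adj (column n (join i j)) (column n f).
pose mid (c : 'I_n) : stacked n n n := inl (inr c).
have toF x : exists c, connect A (outer n x) (mid c) /\ F (outer n x) = merge i j f c.
  case: x => c; exists c; split=> //.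
    by apply: (@connect_lower _ _ _ _ _ (inl c) (inr c)); rewrite labelledE.
  by apply: (@connect_upper _ _ _ _ _ (inr c) (inl c)); rewrite labelledE.
have sym := stack_adj_sym (column n (join i j)) (column n f).
have midf (c d : 'I_n) : f c = f d -> connect A (mid c) (mid d).
  move=> e; apply: (@connect_lower _ _ _ _ _ (inr c) (inr d)).
  by rewrite labelledE /= e.
have midij : connect A (mid (Ordinal hi)) (mid (Ordinal hj)).
  apply: (@connect_upper _ _ _ _ _ (inl (Ordinal hi)) (inl (Ordinal hj))).
  by rewrite labelledE /= /join eqxx if_same.
apply: (@star_labels _ _ _ _ _ _ F).
- by move=> [x|x] [y|y]; rewrite labelledE /= /F /merge /= => /eqP ->.
- have H a b : join i j a = join i j b -> merge i j f a = merge i j f b.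
    rewrite /join /merge; case: eqP => [->|_]; case: eqP => [->|_] //.
    + by move=> <-; rewrite eqxx; case: eqP.
    + by move=> ->; rewrite eqxx; case: eqP.
    + by move=> ->.
  by move=> [x|x] [y|y]; rewrite labelledE /= /F /= => /eqP/H.
- move=> x y; case: (toF x) => c [hc ->]; case: (toF y) => d [hd ->] e.
  apply: connect_trans hc _; rewrite sym; apply: connect_trans hd _; rewrite sym.
  move: e; rewrite /merge; case: eqP => [ec|_]; case: eqP => [ed|_] e.
  + by apply: midf; rewrite ec ed.
  + apply: (connect_trans (midf c (Ordinal hj) ec)); rewrite sym.
    by apply: connect_trans (midf _ _ _) midij.
  + apply: connect_trans (midf _ (Ordinal hi) e) _.
    by apply: connect_trans midij (midf _ _ _).
  + exact: midf.
- by move=> [x|x] [y|y]; rewrite labelledE.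
Qed.

Lemma loops_column g (D : diagram n n) : loops (column n g) D = 0%N.
Proof.
apply: loops_outer => c; exists (inr c).
by apply: (@connect_upper _ _ _ _ _ (inl c) (inr c)); rewrite labelledE.
Qed.

Variable b : nat.
Hypothesis hb : (b.+1 < n)%N.

Definition cross : diagram n n := labelled n n (fun s i => if s then adj b i else i).

Lemma adj_ltn i : (i < n)%N -> (adj b i < n)%N.
Proof. by rewrite /adj; repeat case: ifP => /eqP; lia. Qed.

Definition adj_ord (i : 'I_n) := Ordinal (adj_ltn (ltn_ord i)).

Lemma star_crossr h :
  star (labelled n n h) cross =
  labelled n n (fun s i => h s (if s then i else adj b i)).
Proof.
pose F (u : stacked n n n) := match u with
  | inl (inl i) => h false (adj b i) | inl (inr i) => h false i | inr i => h true i end.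
pose A := stack_adj (labelled n n h) cross.
have sym := stack_adj_sym (labelled n n h) cross.
have toF x : exists v, connect A (outer n x) (upper n v) /\ F (outer n x) = label h v.
  case: x => c; last by exists (inr c).
  exists (inl (adj_ord c)); split=> //.
  apply: (@connect_lower _ _ _ _ _ (inl c) (inr (adj_ord c))).
  by rewrite labelledE /= adjK.
apply: (@star_labels _ _ _ _ _ _ F).
- move=> [x|x] [y|y]; rewrite labelledE /= => /eqP e;
    [by rewrite e | by rewrite e adjK | by rewrite -e adjK |].
  by rewrite (can_inj (adjK b) e).
- by move=> [x|x] [y|y]; rewrite labelledE /= => /eqP e; rewrite ?e.
- move=> x y; case: (toF x) => v [hv ->]; case: (toF y) => w [hw ->] e.
  apply: connect_trans hv _; rewrite sym; apply: connect_trans hw _.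
  by apply: connect_upper; rewrite labelledE e.
- by move=> [x|x] [y|y]; rewrite labelledE.
Qed.

Lemma star_crossl h :
  star cross (labelled n n h) =
  labelled n n (fun s i => h s (if s then adj b i else i)).
Proof.
pose F (u : stacked n n n) := match u with
  | inl (inl i) => h false i | inl (inr i) => h true i | inr i => h true (adj b i) end.
pose A := stack_adj cross (labelled n n h).
have sym := stack_adj_sym cross (labelled n n h).
have toF x : exists v, connect A (outer n x) (lower n v) /\ F (outer n x) = label h v.
  case: x => c; first by exists (inl c).
  exists (inr (adj_ord c)); split=> //.
  by apply: (@connect_upper _ _ _ _ _ (inr c) (inl (adj_ord c))); rewrite labelledE.
apply: (@star_labels _ _ _ _ _ _ F).
- by move=> [x|x] [y|y]; rewrite labelledE /= => /eqP e; rewrite ?e.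
- by move=> [x|x] [y|y]; rewrite labelledE /= => /eqP e; rewrite ?e.
- move=> x y; case: (toF x) => v [hv ->]; case: (toF y) => w [hw ->] e.
  apply: connect_trans hv _; rewrite sym; apply: connect_trans hw _.
  by apply: connect_lower; rewrite labelledE e.
- by move=> [x|x] [y|y]; rewrite labelledE.
Qed.

Lemma loops_crossl (D : diagram n n) : loops cross D = 0%N.
Proof.
apply: loops_outer => c; exists (inr (adj_ord c)).
apply: (@connect_upper _ _ _ _ _ (inl c) (inr (adj_ord c))).
by rewrite labelledE /= adjK.
Qed.

End ColumnStars.

Lemma star_one_block : star (one_block 1 2) (one_block 2 1) = column 2 (fun=> 0%N).
Proof.
rewrite !one_block_labelled.
pose z : 'I_1 := ord0.
have toz x : connect (stack_adj (labelled 1 2 (fun _ _ => 0%N))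
    (labelled 2 1 (fun _ _ => 0%N))) (outer 1 x) (inl (inr z)).
  case: x => c.
    by apply: (@connect_lower _ _ _ _ _ (inl c) (inr z)); rewrite labelledE.
  by apply: (@connect_upper _ _ _ _ _ (inr c) (inl z)); rewrite labelledE.
apply: (@star_labels _ _ _ _ _ _ (fun=> tt)) => //.
  move=> x y _; apply: connect_trans (toz x) _.
  by rewrite stack_adj_sym.
by move=> [x|x] [y|y]; rewrite labelledE.
Qed.

Lemma loops_one_block : loops (one_block 1 2) (one_block 2 1) = 0%N.
Proof.
apply: loops_outer => c; exists (inr ord0).
by apply: (@connect_upper _ _ _ _ _ (inl c) (inr ord0)); rewrite one_block_labelled labelledE.
Qed.

(** The first half of the factorisation: l top vertices are created beside m identity strands, then
    a relation is imposed on all of them. *)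
Lemma star_create m l f :
  star (column (l + m) f) (labelled m (l + m) (fun _ i => i)) =
  labelled m (l + m) (fun _ i => f i).
Proof.
pose F (u : stacked m (l + m) (l + m)) := f (stack_idx u).
pose A := stack_adj (column (l + m) f) (labelled m (l + m) (fun _ i => i)).
have sym := stack_adj_sym (column (l + m) f) (labelled m (l + m) (fun _ i => i)).
have toF x : exists v, connect A (outer _ x) (upper m v) /\
    F (outer _ x) = label (fun _ i => f i) v.
  case: x => c; last by exists (inr c).
  have hc : (c < l + m)%N by have := ltn_ord c; lia.
  exists (inl (Ordinal hc)); split=> //.
  by apply: (@connect_lower _ _ _ _ _ (inl c) (inr (Ordinal hc))); rewrite labelledE.
apply: (@star_labels _ _ _ _ _ _ F).
- by move=> [x|x] [y|y]; rewrite labelledE /= /F /= => /eqP ->.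
- by move=> [x|x] [y|y]; rewrite labelledE /= /F /= => /eqP ->.
- move=> x y; case: (toF x) => v [hv ->]; case: (toF y) => w [hw ->] e.
  apply: connect_trans hv _; rewrite sym; apply: connect_trans hw _.
  by apply: connect_upper; rewrite labelledE e.
- by move=> [x|x] [y|y]; rewrite labelledE.
Qed.

Lemma loops_create m l f : loops (column (l + m) f) (labelled m (l + m) (fun _ i => i)) = 0%N.
Proof.
apply: loops_outer => c; exists (inr c).
by apply: (@connect_upper _ _ _ _ _ (inl c) (inr c)); rewrite labelledE.
Qed.

Section Erase.
Variables (m l : nat) (f : nat -> nat).
Let top := labelled (l + m) (l + 0) (fun s i => if s then (m + i)%N else i).
Let bot := labelled m (l + m) (fun _ i => f i).

(** The second half: the m strands that reach the bottom are cut off at the top, and the l created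
    ones become the top vertices. *)
Lemma star_erase : star top bot =
  labelled m (l + 0) (fun s i => f (if s then (m + i)%N else i)).
Proof.
pose F (u : stacked m (l + m) (l + 0)) := match u with
  | inl (inl i) => f i | inl (inr i) => f i | inr i => f (m + i)%N end.
pose A := stack_adj top bot.
have sym := stack_adj_sym top bot.
have toF x : exists v, connect A (outer _ x) (lower _ v) /\
    F (outer _ x) = label (fun _ i => f i) v.
  case: x => c; first by exists (inl c).
  have hc : (m + c < l + m)%N by have := ltn_ord c; lia.
  exists (inr (Ordinal hc)); split=> //.
  by apply: (@connect_upper _ _ _ _ _ (inr c) (inl (Ordinal hc))); rewrite labelledE.
apply: (@star_labels _ _ _ _ _ _ F).
- by move=> [x|x] [y|y]; rewrite labelledE /= => /eqP.
- by move=> [x|x] [y|y]; rewrite labelledE /= => /eqP ->.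
- move=> x y; case: (toF x) => v [hv ->]; case: (toF y) => w [hw ->] e.
  apply: connect_trans hv _; rewrite sym; apply: connect_trans hw _.
  by apply: connect_lower; rewrite labelledE e.
- by move=> [x|x] [y|y]; rewrite labelledE.
Qed.

Lemma loops_erase : loops top bot = 0%N.
Proof.
apply: loops_outer => c; case: (ltnP c m) => hc.
  exists (inl (Ordinal hc)).
  by apply: (@connect_lower _ _ _ _ _ (inr c) (inl (Ordinal hc))); rewrite labelledE.
have hc' : (c - m < l + 0)%N by have := ltn_ord c; lia.
exists (inr (Ordinal hc')).
apply: (@connect_upper _ _ _ _ _ (inl c) (inr (Ordinal hc'))).
by rewrite labelledE /= subnKC.
Qed.

End Erase.

(** * Operators of diagrams *)

Section Linear.
Variables (R : comPzRingType) (t : R).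

Lemma par_comp_diag m l k (D : diagram l k) (D' : diagram m l) :
  par_comp t (par_diag R D) (par_diag R D') = t ^+ loops D D' *: par_diag R (star D D').
Proof.
rewrite /par_comp (bigD1 D) //= [X in _ + X]big1 ?addr0 => [|E hE].
  rewrite (bigD1 D') //= [X in _ + X]big1 ?addr0 => [|E hE].
    by rewrite !ffunE !eqxx !mul1r.
  by rewrite !ffunE (negbTE hE) mulr0 mul0r scale0r.
by rewrite big1 // => E' _; rewrite !ffunE (negbTE hE) !mul0r scale0r.
Qed.

Lemma par_tens_diag m l m' l' (D : diagram m l) (D' : diagram m' l') :
  par_tens (par_diag R D) (par_diag R D') = par_diag R (juxt D D').
Proof.
rewrite /par_tens (bigD1 D) //= [X in _ + X]big1 ?addr0 => [|E hE].
  rewrite (bigD1 D') //= [X in _ + X]big1 ?addr0 => [|E hE].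
    by rewrite !ffunE !eqxx !mul1r scale1r.
  by rewrite !ffunE (negbTE hE) mulr0 scale0r.
by rewrite big1 // => E' _; rewrite !ffunE (negbTE hE) !mul0r scale0r.
Qed.

Lemma par_hom_sum m l (f : par_hom R m l) : f = \sum_D f D *: par_diag R D.
Proof.
apply/ffunP => E; rewrite sum_ffunE (bigD1 E) //= big1 => [|D hD].
  by rewrite !ffunE eqxx addr0 [RHS]mulr1.
by rewrite !ffunE eq_sym (negbTE hD) [LHS]mulr0.
Qed.

End Linear.

Definition prefix n (x z : stream) : stream :=
  fun j => if (j < n)%N then x j else z (j - n)%N.
Definition suffix n (x : stream) : stream := fun j => x (n + j)%N.

Lemma prefix_suffix n x : prefix n x (suffix n x) = x.
Proof.
by apply: funext => j; rewrite /prefix /suffix; case: ltnP => // h; rewrite subnKC.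
Qed.

Lemma scons_prefix n x z : scons (x 0%N) (prefix n (stl x) z) = prefix n.+1 x z.
Proof. by apply: funext => -[|j]. Qed.

Lemma under_app (R : comPzRingType) n (W : state R -> state R) chi x :
  under n W chi x = W (fun z => chi (prefix n x z)) (suffix n x).
Proof.
elim: n chi x => [|n IH] chi x /=.
  by congr (W _ _); apply: funext => z; congr chi; apply: funext => j; rewrite /prefix subn0.
rewrite pack_app IH; congr (W _ _).
by apply: funext => z; rewrite comp_at_app scons_prefix.
Qed.

(** * The images of the equivalence relations on parallel strands *)

Section Psi.
Variables (R : comPzRingType) (t : R) (Psi : ud_functor t).
Hypothesis hPsi : is_Psi Psi.
Local Notation state := (state R).

Definition acts_diag m l (D : diagram m l) (W : state -> state) :=
  acts t (repr (Psi m l (par_diag R D))) W.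

Lemma acts_diag_class m l (D : diagram m l) f W :
  Psi m l (par_diag R D) = ud_class t f -> acts t f W -> acts_diag D W.
Proof.
move=> h; apply: acts_hteq; apply/ud_classP.
by rewrite ud_reprK.
Qed.

Lemma acts_diag_id n : acts_diag (idp n) id.
Proof. by apply: (@acts_diag_class _ _ _ (tid R (ud n))); [exact: fhom_id|]. Qed.

(** Without loops the composite in Par(t) is a single diagram with coefficient 1. *)
Lemma acts_diag_star m l k (D : diagram l k) (D' : diagram m l) W V :
  loops D D' = 0%N -> acts_diag D W -> acts_diag D' V ->
  acts_diag (star D D') (W \o V).
Proof.
move=> h0 hW hV; apply: acts_diag_class (acts_comp hW hV).
have := par_comp_diag t D D'; rewrite h0 expr0 scale1r => <-.
by rewrite fhom_comp.
Qed.

Lemma acts_diag_juxt m l m' l' (D : diagram m l) (D' : diagram m' l') W V :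
  acts_diag D W -> acts_diag D' V -> acts_diag (juxt D D') (W \o under m V).
Proof.
move=> hW hV; apply: acts_diag_class (acts_tens hW hV).
by rewrite -par_tens_diag fhom_tens.
Qed.

Lemma acts_diag_local a b m (D : diagram m m) W : acts_diag D W ->
  acts_diag (juxt (idp a) (juxt D (idp b))) (under a W).
Proof.
move=> h; have := acts_diag_juxt (@acts_diag_id a) (acts_diag_juxt h (@acts_diag_id b)).
congr acts_diag; apply: funext => chi /=.
congr under; apply: funext => psi /=; congr W; apply: funext => x.
by rewrite under_app prefix_suffix.
Qed.

(* Vertices are numbered from right to left but coordinates from left to right,
   so vertex i carries the coordinate n - 1 - i. *)
Definition consistent n (f : nat -> nat) (x : stream) :=
  forall i j, (i < n)%N -> (j < n)%N -> f i = f j -> x (n.-1 - i)%N = x (n.-1 - j)%N.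

Definition mask n f (chi : state) : state :=
  fun x => if `[< consistent n f x >] then chi x else 0.

Definition good_column n f := acts_diag (column n f) (mask n f).

Lemma good_column_ext n f g : good_column n f ->
  (forall i j, (i < n)%N -> (j < n)%N -> (f i == f j) = (g i == g j)) ->
  good_column n g.
Proof.
move=> h e; rewrite /good_column.
have -> : column n g = column n f.
  by apply: labelled_eq => s i s' i' /=; rewrite !if_same => hi hi'; rewrite e.
suff -> : mask n g = mask n f by [].
apply: funext => chi; apply: funext => x; rewrite /mask.
suff -> : consistent n g x = consistent n f x by [].
apply: propext; split=> c i j hi hj /eqP E; apply: c => //; apply/eqP.
  by rewrite -e.
by rewrite e.
Qed.

Lemma good_column_id n : good_column n id.
Proof.
rewrite /good_column; have -> : column n id = idp n by rewrite idp_labelled.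
have -> : mask n id = id; last exact: acts_diag_id.
apply: funext => chi; apply: funext => x; rewrite /mask.
by case: asboolP => // -[] i j _ _ ->.
Qed.

(** Composing two masks multiplies their indicators: a tuple fits the merged classes exactly when it
    fits the old ones and agrees at i and j. *)
Lemma good_column_merge n i j f : (i < n)%N -> (j < n)%N ->
  good_column n (join i j) -> good_column n f -> good_column n (merge i j f).
Proof.
move=> hi hj h h'; rewrite /good_column -star_join //.
have := acts_diag_star (loops_column _ _) h h'; congr acts_diag.
apply: funext => chi; apply: funext => x; rewrite /mask /=.
have -> : consistent n (merge i j f) x =
    (consistent n (join i j) x /\ consistent n f x).
  apply: propext; split=> [c|[c1 c2] a b ha hb].
    have cf : consistent n f x.
      by move=> a b ha hb e; apply: c => //; rewrite /merge e.
    split=> // a b ha hb; rewrite /join.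
    have ij : x (n.-1 - i)%N = x (n.-1 - j)%N.
      by apply: c => //; rewrite /merge eqxx; case: eqP.
    by case: eqP => [->|_]; case: eqP => [->|_] // e; rewrite -?e -?ij ?e.
  have ij : x (n.-1 - i)%N = x (n.-1 - j)%N.
    by apply: c1 => //; rewrite /join eqxx; case: eqP.
  rewrite /merge; case: eqP => [ea|_]; case: eqP => [eb|_] e.
  + by apply: c2 => //; rewrite ea eb.
  + by rewrite (c2 a j) // -ij; apply: c2.
  + by rewrite (c2 b j) // -ij; apply: c2.
  + exact: c2.
by rewrite asbool_and; do 2![case: asboolP].
Qed.

(** Vertices b and b + 1 counted from the right are coordinates a + 1 and a counted from the
    left. *)
Lemma acts_diag_cross a b :
  acts_diag (cross (a + (2 + b)) b) (fun chi x => chi (x \o adj a)).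
Proof.
have h : acts_diag swap (fun chi => pack (fun a => pack (fun b => chi.@b.@a))).
  exact: acts_diag_class (is_Psi_s hPsi) (acts_s t).
have := @acts_diag_local a b _ _ _ h.
have -> : juxt (idp a) (juxt swap (idp b)) = cross (a + (2 + b)) b.
  rewrite !idp_labelled swap_labelled (@juxt_labelled _ _ _ _ _ _ b) => [|[] //].
  rewrite (@juxt_labelled _ _ _ _ _ _ (2 + b)) => [|s i]; last first.
    by rewrite if_same /= /adj; case: s; repeat case: ifP => /eqP; lia.
  apply: labelled_eq => s i s' i' hi hi' /=; rewrite !if_same.
  have E c k : (if (k < 2 + b)%N then
       if (k < b)%N then k else (b + (if c then adj 0 (k - b) else k - b))%N
      else (2 + b + (k - (2 + b)))%N) = if c then adj b k else k.
    by rewrite /adj; case: c; repeat case: ifP => /eqP; lia.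
  by rewrite !E.
congr acts_diag; apply: funext => chi; apply: funext => x.
rewrite under_app !pack_app !comp_at_app; congr chi; apply: funext => j.
rewrite /prefix /suffix /stl /scons /adj /=.
case: ltnP => hj; first by rewrite !ifN //; lia.
case e: (j - a)%N => [|[|c]].
- by rewrite addn1 ifT //; lia.
- by rewrite addn0 ifN ?ifT //; lia.
- by rewrite -e subnKC // !ifN //; lia.
Qed.

Lemma good_column_join_next a b :
  good_column (a + (2 + b)) (join b b.+1).
Proof.
have h : acts_diag (column 2 (fun=> 0%N))
    (fun chi => pack (fun a => pack (fun b => if a == b then chi.@a.@b else vzero R))).
  rewrite -star_one_block.
  have h1 := acts_diag_class (is_Psi_mu hPsi) (acts_mu t).
  have h2 := acts_diag_class (is_Psi_delta hPsi) (acts_delta t).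
  have := acts_diag_star loops_one_block h2 h1; congr acts_diag.
  apply: funext => chi /=; congr pack; apply: funext => c; congr pack.
  by apply: funext => d; case: eqP => [->|].
have := @acts_diag_local a b _ _ _ h.
have -> : juxt (idp a) (juxt (column 2 (fun=> 0%N)) (idp b)) =
    column (a + (2 + b)) (join b b.+1).
  rewrite !idp_labelled (@juxt_labelled _ _ _ _ _ _ b) => [|[] //].
  rewrite (@juxt_labelled _ _ _ _ _ _ (2 + b)) => [|s i]; last first.
    by rewrite if_same /=; case: ifP; lia.
  apply: labelled_eq => s i s' i' hi hi' /=; rewrite !if_same /join.
  by repeat case: ifP => /eqP; lia.
congr acts_diag; apply: funext => chi; apply: funext => x.
rewrite under_app pack_app pack_app /mask.
have -> : consistent (a + (2 + b)) (join b b.+1) x = (x a == x a.+1) :> Prop.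
  apply: propext; split=> [c|/eqP e i j hi hj].
    have /= := c b b.+1; rewrite /join eqxx if_same => h'; apply/eqP.
    have ea : a = ((a + (2 + b)).-1 - b.+1)%N by lia.
    have eb : a.+1 = ((a + (2 + b)).-1 - b)%N by lia.
    by rewrite {1}ea eb; apply/esym/h' => //; lia.
  have ea : ((a + (2 + b)).-1 - b.+1)%N = a by lia.
  have eb : ((a + (2 + b)).-1 - b)%N = a.+1 by lia.
  rewrite /join; case: eqP => [->|_]; case: eqP => [->|_] // e'.
  - by rewrite -e' ea eb e.
  - by rewrite e' ea eb e.
  - by rewrite e'.
rewrite asboolb /suffix /stl addn0 addn1.
case: eqP => // e; rewrite !comp_at_app; congr chi; apply: funext => j.
rewrite /prefix /scons; case: ltnP => hj //.
case e' : (j - a)%N => [|[|c]]; rewrite /= -?addnS -?e' ?subnKC //.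
- by congr x; lia.
- by congr x; lia.
Qed.

Lemma good_column_adj n b f : (b.+1 < n)%N ->
  good_column n f -> good_column n (f \o adj b).
Proof.
move=> hb h; have [a en] : exists a, n = (a + (2 + b))%N.
  by exists (n - (2 + b))%N; lia.
rewrite en in hb h *.
have hc := @acts_diag_cross a b.
have h0 := loops_crossl hb (star (column (a + (2 + b)) f) (cross (a + (2 + b)) b)).
have := acts_diag_star h0 hc (acts_diag_star (loops_column _ _) h hc).
rewrite (star_crossr hb) (star_crossl hb) /good_column.
have -> : labelled (a + (2 + b)) (a + (2 + b)) (fun s i =>
    f (if s then if s then adj b i else i else adj b (if s then adj b i else i))) =
    column (a + (2 + b)) (f \o adj b).
  by apply: labelled_eq => -[] i [].
congr acts_diag; apply: funext => chi; apply: funext => x; rewrite /= /mask.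
have -> : consistent (a + (2 + b)) f (x \o adj a) = consistent (a + (2 + b)) (f \o adj b) x.
  have E i : (i < a + (2 + b))%N ->
      adj a ((a + (2 + b)).-1 - i)%N = ((a + (2 + b)).-1 - adj b i)%N.
    by rewrite /adj => hi; repeat case: ifP => /eqP; lia.
  have lt i : (i < a + (2 + b))%N -> (adj b i < a + (2 + b))%N by exact: adj_ltn.
  apply: propext; split=> c i j hi hj /= e.
    have := c _ _ (lt _ hi) (lt _ hj) e.
    by rewrite /= !E ?lt // !adjK.
  by rewrite !E //; apply: c; rewrite ?lt //= !adjK.
by case: asboolP => // _; congr chi; apply: funext => j /=; rewrite adjK.
Qed.

(** For adjacent vertices this is delta after mu on two strands; conjugation by crossings then moves
    the vertex j away from i. *)
Lemma good_column_join n i j : (i < j)%N -> (j < n)%N -> good_column n (join i j).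
Proof.
elim: j => // j IH; rewrite ltnS leq_eqVlt => /orP[/eqP <-|hij] hj.
  have -> : n = ((n - (2 + i)) + (2 + i))%N by lia.
  exact: good_column_join_next.
apply: good_column_ext (good_column_adj hj (IH hij (ltnW hj))) _ => a b _ _.
by rewrite /join /adj /=; repeat case: ifP => /eqP; lia.
Qed.

(* Every equivalence relation is generated by the pairs that it relates. *)
Lemma good_column_exists n (e : rel nat) : equivalence_rel e ->
  exists f, good_column n f /\
    forall i j, (i < n)%N -> (j < n)%N -> (f i == f j) = e i j.
Proof.
case/equivalence_relP => er tr.
have es x y : e x y -> e y x by move=> h; rewrite -(tr _ _ h).
pose pairs := [seq ij <- [seq (i, j) | i <- iota 0 n, j <- iota 0 n] |
   (ij.1 < ij.2)%N && e ij.1 ij.2].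
have hp ij : ij \in pairs -> [&& ij.1 < ij.2, ij.2 < n & e ij.1 ij.2]%N.
  rewrite mem_filter => /andP[/andP[-> ->]] /allpairsP[[a b] /= [_ + ->]].
  by rewrite mem_iota /= andbT.
(* The pairs are merged one at a time; the invariant is that equal labels imply [e], so that nothing
   too coarse arises. *)
have [f [gf hf1 hf2]] : exists f, [/\ good_column n f,
    (forall i j, f i = f j -> e i j) & (forall ij, ij \in pairs -> f ij.1 = f ij.2)].
  elim: pairs hp => [|[a b] s IH] hp.
    by exists id; split=> // [|i j ->]; [exact: good_column_id | exact: er].
  have [|f [gf h1 h2]] := IH; first by move=> ij hij; apply: hp; rewrite inE hij orbT.
  have /and3P[/= hab hb eab] := hp (a, b) (mem_head _ _).
  exists (merge a b f); split.
  - apply: good_column_merge => //; [lia|exact: good_column_join].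
  - move=> i j; rewrite /merge; case: eqP => [ei|_]; case: eqP => [ej|_] E.
    + by apply: h1; rewrite ei ej.
    + rewrite (tr _ _ (h1 _ _ ei)) (tr _ _ (es _ _ eab)); exact: h1.
    + rewrite (tr _ _ (h1 _ _ E)) (tr _ _ eab); apply: es; exact: h1.
    + exact: h1.
  - move=> ij; rewrite inE => /orP[/eqP ->|hij] /=.
      by rewrite /merge eqxx; case: eqP => // <-.
    by rewrite /merge (h2 _ hij).
exists f; split=> // i j hi hj; apply/eqP/idP; first exact: hf1.
have key a b : (a < n)%N -> (b < n)%N -> (a < b)%N -> e a b -> f a = f b.
  move=> ha hb hab E; apply: (hf2 (a, b)); rewrite mem_filter /= hab E /=.
  by apply/allpairsP; exists (a, b); rewrite /= !mem_iota.
move=> E; case: (ltngtP i j) => [h|h|-> //]; first exact: key.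
by apply/esym/key => //; exact: es.
Qed.

End Psi.

Lemma suffix_prefix n x z : suffix n (prefix n x z) = z.
Proof.
by apply: funext => j; rewrite /suffix /prefix ltnNge leq_addr /= addKn.
Qed.

Lemma consistent_ext n f x y : (forall j, (j < n)%N -> x j = y j) ->
  consistent n f x -> consistent n f y.
Proof. by move=> e c i j hi hj E; rewrite -!e; [exact: c | lia | lia]. Qed.

(** * Evaluation and faithfulness *)

Section Evaluation.
Variables (R : comPzRingType) (t : R).
Local Notation state := (state R).

Fixpoint integs m (chi : state) : state :=
  if m is m'.+1 then fun x => integ t (fun i => integs m' chi.@i x) else chi.

Lemma integs_zero m : integs m (vzero R) = vzero R.
Proof.
elim: m => //= m IH; apply: funext => x.
have -> : (fun i => integs m (vzero R).@i x) = (fun=> 0).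
  by apply: funext => i; rewrite vzero_at IH.
by rewrite integ_cst mulr0.
Qed.

Lemma integs_delta m (g : stream -> R) z x :
  integs m (fun y => g y * delta R m z y) x = g (prefix m z x).
Proof.
elim: m g z => [|m IH] g z /=.
  by rewrite mulr1; congr g; apply: funext => j; rewrite /prefix subn0.
rewrite (@integ_point _ _ (z 0%N)) => [|i hi].
  rewrite -scons_prefix -(IH (fun y => g (scons (z 0%N) y)) (stl z)).
  congr (integs _ _ _); apply: funext => y.
  by rewrite comp_at_app /vpoint pack_app eqxx.
transitivity (integs m (vzero R) x); last by rewrite integs_zero.
congr (integs _ _ _); apply: funext => y.
by rewrite comp_at_app /vpoint pack_app (negbTE hi) mulr0.
Qed.

Variable Psi : ud_functor t.
Hypothesis hPsi : is_Psi Psi.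

Lemma acts_diag_eq m l (D E : diagram m l) W V :
  acts_diag Psi D W -> D = E -> W =1 V -> acts_diag Psi E V.
Proof. by move=> h <- /funext <-. Qed.

Lemma acts_create0 l : acts_diag Psi (labelled 0 l (fun _ i => i))
  (fun chi x => chi (suffix l x)).
Proof.
elim: l => [|l IH].
  have := @acts_diag_id _ _ Psi 0; rewrite idp_labelled; congr acts_diag.
have h := acts_diag_class (is_Psi_eta hPsi) (acts_eta t).
have := acts_diag_juxt h IH; rewrite one_block_labelled (@juxt_labelled _ _ _ _ _ _ l).
  have -> : labelled (0 + 0) (1 + l) (fun s i => let c := if s then l else 0%N in
     if (i < c)%N then i else (l + 0)%N) = labelled 0 l.+1 (fun _ i => i).
    by apply: labelled_eq => -[] i [] // i' hi hi' /=; repeat case: ifP; lia.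
  by congr acts_diag; apply: funext => chi; apply: funext => x; rewrite /= pack_app.
by case.
Qed.

Lemma acts_create l m : acts_diag Psi (labelled m (l + m) (fun _ i => i))
  (fun chi x => chi (suffix l x)).
Proof.
have := acts_diag_juxt (@acts_create0 l) (@acts_diag_id _ _ Psi m).
rewrite idp_labelled (@juxt_labelled _ _ _ _ _ _ m) => [|[] //].
move/acts_diag_eq; apply=> //.
by apply: labelled_eq => s i s' i' hi hi' /=; rewrite !if_same; repeat case: ifP; lia.
Qed.

Lemma acts_erase0 m : acts_diag Psi (labelled m 0 (fun _ i => i)) (integs m).
Proof.
elim: m => [|m IH].
  by have := @acts_diag_id _ _ Psi 0; rewrite idp_labelled.
have h := acts_diag_class (is_Psi_eps hPsi) (acts_eps t).
have := acts_diag_juxt h IH; rewrite one_block_labelled (@juxt_labelled _ _ _ _ _ _ m).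
  have -> : labelled (1 + m) (0 + 0) (fun s i => let c := if s then 0%N else m in
     if (i < c)%N then i else (m + 0)%N) = labelled m.+1 0 (fun _ i => i).
    by apply: labelled_eq => -[] i [] // i' hi hi' /=; repeat case: ifP; lia.
  by [].
by case.
Qed.

Lemma acts_erase l m :
  acts_diag Psi (labelled (l + m) (l + 0) (fun s i => if s then (m + i)%N else i))
    (under l (integs m)).
Proof.
have := acts_diag_juxt (@acts_diag_id _ _ Psi l) (@acts_erase0 m).
rewrite idp_labelled (@juxt_labelled _ _ _ _ _ _ m) => [|[] //].
move/acts_diag_eq; apply=> //.
by apply: labelled_eq => -[] i [] i' hi hi' /=; repeat case: ifP; lia.
Qed.

Definition finer m l (D E : diagram m l) :=
  [forall x, forall y, same_block D x y ==> same_block E x y].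

(** The position of a vertex among the l + m strands of the factorisation, where the created strands
    follow the m old ones. *)
Definition vertex_idx m l (x : vertex m l) : nat :=
  match x with inl i => i | inr j => (m + j)%N end.

(* The target is [l + 0] rather than [l] since [juxt (idp l) E] has this target
   when [E] has target 0. *)
Lemma diagram_column m l (D : diagram m (l + 0)) : exists f,
  good_column Psi (l + m) f /\
  D = labelled m (l + 0) (fun s i => f (if s then (m + i)%N else i)).
Proof.
pose F i : {set vertex m (l + 0)} :=
  if insub i is Some a then pblock (val D) (inl a : vertex m (l + 0))
  else if insub (i - m)%N is Some b then pblock (val D) (inr b : vertex m (l + 0))
  else set0.
have FE (x : vertex m (l + 0)) : F (vertex_idx x) = pblock (val D) x.
  case: x => i; rewrite /F /=; first by rewrite valK.
  by rewrite insubF ?addKn ?valK // ltnNge leq_addr.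
have [f [gf hf]] := good_column_exists hPsi (l + m) (fibers_equiv F).
exists f; split=> //; apply: diagramP => x y; rewrite labelledE.
have lt (v : vertex m (l + 0)) : (vertex_idx v < l + m)%N.
  by case: v => i /=; have := ltn_ord i; lia.
have -> : same_block D x y = (pblock (val D) x == pblock (val D) y).
  rewrite eq_pblock ?(partition_trivIset (valP D)) //.
  by rewrite (cover_partition (valP D)) inE.
have lab (v : vertex m (l + 0)) :
    label (fun s i => f (if s then (m + i)%N else i)) v = f (vertex_idx v) by case: v.
by rewrite !lab hf //= !FE.
Qed.

(** The entry of the kernel of D at a tuple with distinct values on distinct blocks of D0: it is 1
    exactly when this tuple is constant on the blocks of D. *)
Lemma evaluation m l (D0 : diagram m l) : exists N phi X,
  smooth (ud m ++ ud 0) phi /\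
  forall D, named N (interp (repr (Psi m l (par_diag R D))) (ud 0) t phi) X =
    (finer D D0)%:R.
Proof.
have E : l = (l + 0)%N by rewrite addn0.
move: D0; rewrite E => D0.
have [f0 [_ e0]] := diagram_column D0.
(* Coordinates run opposite to vertices, so the first l entries label the top of D0 and the next m
   its bottom. The point mass sits at the latter, and the result is read off at the former. *)
pose X : stream := fun j => f0 ((l + m).-1 - j)%N.
exists (l + 0 + 0)%N, (unnamed (m + 0) (delta R (m + 0) (suffix l X))), X.
rewrite udD; split=> [|D]; first exact: delta_smooth.
have [f [gf eD]] := diagram_column D.
have hD := acts_diag_star (loops_create m l f) gf (@acts_create l m).
rewrite star_create in hD.
have {hD} := acts_diag_star (loops_erase m l f) (@acts_erase l m) hD.
rewrite star_erase -eD => ->; last exact: delta_smooth.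
rewrite unnamedK addn0 /= under_app.
(* Creation, mask and erasure amount to integrating the indicator against the point mass, which
   leaves its value at that point. *)
transitivity (integs m (fun y => (`[< consistent (l + m) f (prefix l X y) >])%:R *
   delta R m (suffix l X) y) (suffix l X)).
  congr integs; apply: funext => y; rewrite /mask suffix_prefix.
  by case: asboolP => _; rewrite ?mul1r ?mul0r.
rewrite integs_delta; congr (_%:R); congr nat_of_bool.
have agree j : (j < l + m)%N -> prefix l X (prefix m (suffix l X) (suffix l X)) j = X j.
  move=> hj; rewrite /prefix /suffix; case: ltnP => // hl.
  by rewrite ifT ?subnKC //; lia.
have lt (v : vertex m (l + 0)) : (vertex_idx v < l + m)%N.
  by case: v => i /=; have := ltn_ord i; lia.
have lab g (v : vertex m (l + 0)) :
    label (fun s i => g (if s then (m + i)%N else i)) v = g (vertex_idx v) by case: v.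
apply/asboolP/'forall_forallP => [c x y|h].
  apply/implyP; rewrite eD {1}e0 !labelledE !lab => /eqP e.
  have := consistent_ext agree c (lt x) (lt y) e; rewrite /X.
  by rewrite !subKn => [-> //||]; have := lt x; have := lt y; lia.
have {}agree j : (j < l + m)%N -> X j = prefix l X (prefix m (suffix l X) (suffix l X)) j.
  by move=> hj; rewrite agree.
apply: (consistent_ext agree) => i j hi hj e; rewrite /X !subKn; try lia.
have vtx c : (c < l + m)%N -> exists v : vertex m (l + 0), vertex_idx v = c.
  move=> hc; case: (ltnP c m) => hm; first by exists (inl (Ordinal hm)).
  have hc' : (c - m < l + 0)%N by lia.
  by exists (inr (Ordinal hc')); rewrite /= subnKC.
have [x ex] := vtx _ hi; have [y ey] := vtx _ hj.
have := h x y; rewrite eD e0 !labelledE !lab ex ey e eqxx.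
by move/eqP.
Qed.

Lemma interp_class m l (f : term R (ud m) (ud l)) r phi : smooth (ud m ++ r) phi ->
  interp (repr (ud_class t f)) r t phi = interp f r t phi.
Proof. exact/hteq_sound/hteq_repr. Qed.

Lemma finer_card m l (D E : diagram m l) : finer D E -> D != E ->
  (#|[set p | same_block D p.1 p.2]| < #|[set p | same_block E p.1 p.2]|)%N.
Proof.
move=> /forallP h hDE; apply: proper_card; rewrite properEneq; apply/andP; split.
  apply: contraNneq hDE => /setP e; apply/eqP/diagramP => x y.
  by have := e (x, y); rewrite !inE.
by apply/subsetP => -[x y]; rewrite !inE /= => /(implyP (forallP (h x) y)).
Qed.

End Evaluation.

Theorem theorem5p2 (R : comPzRingType) (t : R) (Psi : ud_functor t) :
  is_Psi Psi -> is_faithful Psi.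
Proof.
move=> hPsi m l f g e; apply/eqP; rewrite -subr_eq0; apply/eqP.
have : Psi m l (f - g) = 0 by rewrite linearB e subrr.
move: (f - g) => {e f g} h h0.
have sum0 D0 : \sum_D h D * (finer D D0)%:R = 0.
  have [N [phi [X [hphi ev]]]] := evaluation hPsi D0.
  have [s hs] := named_pre R N.
  (* The evaluation as a linear functional on the Hom module: [hteq_sound] makes it independent of
     representatives, and [named] is linear as a precomposition. *)
  pose L (u : ud_hom t m l) := named N (interp (repr u) (ud 0) t phi) X.
  have LZD a u v : L (a *: u + v) = a * L u + L v.
    rewrite /L -{1}(ud_reprK u) -{1}(ud_reprK v) ud_classZ ud_classD interp_class //=.
    by rewrite !hs /= /vlin mul1r /vzero addr0.
  have L0 : L 0 = 0.
    by rewrite /L [0]/(ud_class t (tzero R _ _)) interp_class // hs.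
  have LD : {morph L : u v / u + v} by move=> u v; rewrite -{1}[u]scale1r LZD mul1r.
  transitivity (L (Psi m l h)); last by rewrite h0.
  rewrite [in RHS](par_hom_sum h) linear_sum (big_morph L LD L0).
  apply: eq_bigr => D _; rewrite linearZZ -ev -[in RHS](addr0 (h D *: _)) LZD L0 addr0 //.
apply/ffunP => D0; rewrite ffunE.
(* Unitriangularity: a diagram strictly finer than D0 relates fewer pairs of vertices, so its
   coefficient is already known to vanish and [sum0 D0] reduces to [h D0]. *)
have [n] := ubnP #|[set p | same_block D0 p.1 p.2]|.
elim: n D0 => // n IH D0; rewrite ltnS => hn.
have := sum0 D0; rewrite (bigD1 D0) //= big1 ?addr0 => [|D hD].
  have -> : finer D0 D0 by apply/forallP => x; apply/forallP => y; apply/implyP.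
  by rewrite mulr1.
case fD : (finer D D0); last by rewrite mulr0.
by rewrite IH ?mul0r // (leq_trans (finer_card fD hD)).
Qed.
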